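(* Let $m>1$ be real and let $(M^n,g,w)$ be a $(\lambda,n+m)$-Einstein manifold. Then $$\mathrm{div}(w^{m+1}Q)=0.$$
   Context: A $(\lambda,n+m)$-Einstein manifold $(M^n,g,w)$ (for $m>1$) is a connected complete Riemannian $n$-manifold $(M,g)$, possibly with boundary, together with a smooth function $w$ on $M$ such that $\mathrm{Hess}\,w=\frac{w}{m}(\mathrm{Ric}-\lambda g)$ on $M$, $w>0$ on $\mathrm{int}(M)$, and $w=0$ on $\partial M$. Define the function $\rho=\frac{1}{m-1}\bigl((n-1)\lambda-\mathrm{scal}\bigr)$ and the $(0,4)$-tensor $$Q=R+\frac2m\mathrm{Ric}\odot g-\frac{\lambda+\rho}{m}g\odot g.$$ For symmetric $(0,2)$-tensors $s,r$, $$(s\odot r)(X,Y,Z,W)=\tfrac12\bigl(r(X,W)s(Y,Z)+r(Y,Z)s(X,W)-r(X,Z)s(Y,W)-r(Y,W)s(X,Z)\bigr).$$ The curvature tensor convention is $R(X,Y,Z,W)=g(\nabla_X\nabla_YZ-\nabla_Y\nabla_XZ-\nabla_{[X,Y]}Z,W)$, so $\mathrm{Ric}(X,Y)=\sum_iR(X,E_i,E_i,Y)$ for an orthonormal basis $E_i$. The divergence of a $(0,4)$-tensor $T$ is $(\mathrm{div}\,T)(X,Y,Z)=\sum_i(\nabla_{E_i}T)(X,Y,Z,E_i)$. ($Q$ has the symmetries of a curvature tensor, so contracting in another slot gives the same vanishing statement.) *)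

(* Defs.v *)
From HB Require Import structures.
From mathcomp Require Import all_boot all_order all_algebra.
From mathcomp Require Import ring.
From mathcomp Require Import all_classical all_reals all_analysis.
Import Order.TTheory GRing.Theory Num.Theory.
Import numFieldNormedType.Exports.

Set Implicit Arguments.
Unset Strict Implicit.
Unset Printing Implicit Defensive.

Local Open Scope classical_set_scope.
Local Open Scope ring_scope.

(** * Calculus up to the boundary *)

Section Calculus.
Context {R : realType} {V W : normedModType R}.

(* Used for finite-dimensional V only, where it is the usual class C^k. *)
Fixpoint Ck (k : nat) (U : set V) (f : V -> W) : Prop :=
  (forall x, U x -> {for x, continuous f}) /\
  match k with
  | 0%N => True
  | k'.+1 => forall v : V,
      (forall x, U x -> derivable f x v) /\ Ck k' U (fun x => 'D_v f x)
  end.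

(* The set A need not be open: f is smooth on A when it locally extends to a
   smooth function on an open set.  The values of f outside A are irrelevant. *)
Definition smooth_on (A : set V) (f : V -> W) : Prop :=
  forall x, A x -> exists U : set V, exists F : V -> W,
    [/\ open U, U x, (forall k, Ck k U F)
      & forall y, U y -> A y -> F y = f y].

(* Directional derivative of f at x, computed inside A: the two-sided
   derivative when A is a neighbourhood of x, the one-sided derivative along a
   direction that is transverse to the boundary of A at x. *)
Definition dwithin (A : set V) (f : V -> W) (x v : V) : W :=
  lim (h^-1 *: (f (h *: v + x) - f x)
         @[h --> within [set h : R | A (h *: v + x)] (0 : R)^']).

Lemma dwithin_interior (A : set V) (f : V -> W) (x v : V) :
  nbhs x A -> dwithin A f x v = 'D_v f x.
Proof.
move=> Ax.
have nA : nbhs (0 : R) [set h : R | A (h *: v + x)].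
  have : (fun h : R => h *: v + x) @ (0 : R) --> (0 : R) *: v + x.
    by apply: cvgD; [apply: cvgZr_tmp; exact: cvg_id | exact: cvg_cst].
  by rewrite scale0r add0r => /(_ A Ax).
have E : within [set h : R | A (h *: v + x)] (0 : R)^' = (0 : R)^'.
  apply/seteqP; split => B.
  - by apply: filterS2 (nbhs_dnbhs nA) => h Ah; exact.
  - by apply: filterS => h.
by rewrite /dwithin E.
Qed.

End Calculus.

(** * Smooth manifolds with boundary *)

(* {x in R^n | x_0 >= 0}; the condition is void when n = 0. *)
Definition half_space (R : realType) (n : nat) : set 'rV[R]_n :=
  [set x | forall i : 'I_n, i = 0%N :> nat -> 0 <= x ord0 i].

Definition half_space_bnd (R : realType) (n : nat) : set 'rV[R]_n :=
  [set x | exists2 i : 'I_n, i = 0%N :> nat & x ord0 i = 0].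

Arguments half_space {R n}.
Arguments half_space_bnd {R n}.

(* chart i is the coordinate map on the domain dom i, and param i its inverse
   on the coordinate set chart i @` dom i; both are total functions whose
   values elsewhere are irrelevant. *)
Record smooth_manifold (R : realType) (n : nat) := SmoothManifold {
  carrier :> topologicalType;
  cindex : Type;
  dom : cindex -> set carrier;
  chart : cindex -> carrier -> 'rV[R]_n;
  param : cindex -> 'rV[R]_n -> carrier;
  manifold_hausdorff : hausdorff_space carrier;
  manifold_second_countable : @second_countable carrier;
  dom_open : forall i, open (dom i);
  dom_cover : forall p, exists i, dom i p;
  chart_image_open : forall i, exists2 O : set 'rV[R]_n,
    open O & chart i @` dom i = O `&` half_space;
  chartK : forall i p, dom i p -> param i (chart i p) = p;
  chart_continuous : forall i, {within dom i, continuous (chart i)};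
  param_continuous : forall i,
    {within chart i @` dom i, continuous (param i)};
  transition_smooth : forall i j,
    smooth_on (chart i @` (dom i `&` dom j)) (chart j \o param i)
}.

Section Manifold.
Context {R : realType} {n : nat} (M : smooth_manifold R n).

Definition coords (i : cindex M) : set 'rV[R]_n := chart i @` dom i.

Definition boundary : set M :=
  [set p | exists2 i, dom i p & half_space_bnd (chart i p)].

Definition smooth_fun (f : M -> R) : Prop :=
  forall i, smooth_on (coords i) (f \o param i).

End Manifold.

(** * Riemannian metrics *)

(* The metric is given by its coordinate matrices g_i in each chart; [dot] is
   the corresponding inner product of tangent vectors at x. *)
Definition dot (R : realType) (n : nat) (G : 'rV[R]_n -> 'M[R]_n)
  (x u v : 'rV[R]_n) : R := (u *m G x *m v^T) ord0 ord0.

Record riemannian_metric (R : realType) (n : nat) (M : smooth_manifold R n) :=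
  RiemannianMetric {
  gmx :> cindex M -> 'rV[R]_n -> 'M[R]_n;
  gmx_smooth : forall i, smooth_on (coords i) (gmx i);
  gmx_sym : forall i x, coords i x -> (gmx i x)^T = gmx i x;
  gmx_posdef : forall i x u, coords i x -> u != 0 -> 0 < dot (gmx i) x u u;
  gmx_compat : forall (i j : cindex M) (p : M), dom i p -> dom j p ->
    let dtau := dwithin half_space (chart j \o param i) (chart i p) in
    forall u v, dot (gmx i) (chart i p) u v =
                dot (gmx j) (chart j p) (dtau u) (dtau v)
}.

Section Distance.
Context {R : realType} {n : nat} {M : smooth_manifold R n}.
Variable g : riemannian_metric M.

Definition smooth_curve (c : R -> M) : Prop :=
  {within `[0, 1], continuous c} /\
  forall i, smooth_on ((`[0, 1] `&` c @^-1` dom i) : set R^o) (chart i \o c).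

(* |c'(t)|_g computed in any chart around c t. *)
Definition speed (c : R -> M) (t : R) : R :=
  xget 0 [set s | exists2 i, dom i (c t) &
    let v := dwithin (`[0, 1] : set R^o) (chart i \o c) t 1 in
    s = Num.sqrt (dot (g i) (chart i (c t)) v v)].

Definition curve_length (c : R -> M) : \bar R :=
  (\int[lebesgue_measure]_(t in `[0%R, 1%R]) (speed c t)%:E)%E.

(* s is a piecewise smooth path from p to q, cut into its smooth pieces. *)
Fixpoint pw_smooth_path (p q : M) (s : seq (R -> M)) : Prop :=
  match s with
  | [::] => p = q
  | c :: s' => [/\ smooth_curve c, c 0 = p & pw_smooth_path (c 1) q s']
  end.

Definition rdist (p q : M) : \bar R :=
  ereal_inf [set (\sum_(c <- s) curve_length c)%E | s in pw_smooth_path p q].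

Definition complete_metric : Prop :=
  forall u : nat -> M,
    (forall e : R, 0 < e -> exists N : nat, forall i j : nat,
       (N <= i)%N -> (N <= j)%N -> (rdist (u i) (u j) < e%:E)%E) ->
    exists p : M, forall e : R, 0 < e -> exists N : nat, forall i : nat,
       (N <= i)%N -> (rdist (u i) p < e%:E)%E.

End Distance.

(** * Tensor calculus in a chart

   Throughout, G is the coordinate matrix of the metric in a chart, a vector
   field is given by its coordinates, and a (0,k)-tensor field is a function of
   k vector fields with values in functions on the coordinate set.  All
   derivatives are taken inside the half-space. *)

Section TensorCalculus.
Context {R : realType} {n : nat}.
Variable G : 'rV[R]_n -> 'M[R]_n.

Definition vfield := 'rV[R]_n -> 'rV[R]_n.
Definition tensor2 := vfield -> vfield -> 'rV[R]_n -> R.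
Definition tensor4 := vfield -> vfield -> vfield -> vfield -> 'rV[R]_n -> R.

Implicit Types (X Y Z U V W : vfield) (f : 'rV[R]_n -> R) (x : 'rV[R]_n).

Definition coord_field (i : 'I_n) : vfield := fun=> delta_mx ord0 i.

Definition lie_der X f : 'rV[R]_n -> R := fun x => dwithin half_space f x (X x).

Definition lie_bracket X Y : vfield := fun x =>
  dwithin half_space Y x (X x) - dwithin half_space X x (Y x).

(* dmetric i j k is the partial derivative d_i g_jk. *)
Definition dmetric (i j k : 'I_n) x : R :=
  dwithin half_space (fun y => G y j k) x (delta_mx ord0 i).

(* christoffel k i j is Gamma^k_ij of the Levi-Civita connection. *)
Definition christoffel (k i j : 'I_n) x : R :=
  2^-1 * \sum_l invmx (G x) k l *
           (dmetric i j l x + dmetric j i l x - dmetric l i j x).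

(* Levi-Civita covariant derivative of Y along X. *)
Definition nabla X Y : vfield := fun x =>
  dwithin half_space Y x (X x) +
  \row_k \sum_i \sum_j christoffel k i j x * X x ord0 i * Y x ord0 j.

Definition curvature X Y Z : vfield := fun x =>
  nabla X (nabla Y Z) x - nabla Y (nabla X Z) x - nabla (lie_bracket X Y) Z x.

Definition metric : tensor2 := fun X Y x => dot G x (X x) (Y x).

Definition Rm : tensor4 := fun X Y Z W x => dot G x (curvature X Y Z x) (W x).

(* The contraction \sum_i T(E_i, E_i) over an orthonormal basis (E_i), written
   in the coordinate basis; see [mtrace_orthonormal]. *)
Definition mtrace (T : tensor2) : 'rV[R]_n -> R := fun x =>
  \sum_i \sum_j invmx (G x) i j * T (coord_field i) (coord_field j) x.

Definition Ric : tensor2 := fun X Y => mtrace (fun U V => Rm X U V Y).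

Definition scal : 'rV[R]_n -> R := mtrace Ric.

Definition Hess f : tensor2 := fun X Y x =>
  lie_der X (lie_der Y f) x - lie_der (nabla X Y) f x.

Definition odot (s r : tensor2) : tensor4 := fun X Y Z W x =>
  2^-1 * (r X W x * s Y Z x + r Y Z x * s X W x
          - r X Z x * s Y W x - r Y W x * s X Z x).

Definition nabla4 U (T : tensor4) : tensor4 := fun X Y Z W x =>
  lie_der U (T X Y Z W) x
  - T (nabla U X) Y Z W x - T X (nabla U Y) Z W x
  - T X Y (nabla U Z) W x - T X Y Z (nabla U W) x.

Definition div4 (T : tensor4) : vfield -> vfield -> vfield -> 'rV[R]_n -> R :=
  fun X Y Z => mtrace (fun U V => nabla4 U T X Y Z V).

Definition rho (lambda m : R) : 'rV[R]_n -> R := fun x =>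
  (m - 1)^-1 * ((n%:R - 1) * lambda - scal x).

Definition Qtensor (lambda m : R) : tensor4 := fun X Y Z W x =>
  Rm X Y Z W x + 2 / m * odot Ric metric X Y Z W x
  - (lambda + rho lambda m x) / m * odot metric metric X Y Z W x.

Definition fscale f (T : tensor4) : tensor4 :=
  fun X Y Z W x => f x * T X Y Z W x.

(** Sanity checks: the contraction, and the two properties characterizing the
    Levi-Civita connection. *)

Lemma mtrace_orthonormal (T : tensor2) x (E : 'M[R]_n) :
  (forall v, scalar (fun u => T (cst u) (cst v) x)) ->
  (forall u, scalar (fun v => T (cst u) (cst v) x)) ->
  (forall i j, dot G x (row i E) (row j E) = (i == j)%:R) ->
  mtrace T x = \sum_i T (cst (row i E)) (cst (row i E)) x.
Proof.
move=> Tl Tr orth.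
pose A u v := T (cst u) (cst v) x.
have Al v a u u' : A (a *: u + u') v = a * A u v + A u' v by exact: Tl.
have Ar u a v v' : A u (a *: v + v') = a * A u v + A u v' by exact: Tr.
have A0l v : A 0 v = 0.
  have := Al v 1 0 0; rewrite scaler0 addr0 mul1r => /eqP.
  by rewrite -subr_eq subrr eq_sym => /eqP.
have A0r u : A u 0 = 0.
  have := Ar u 1 0 0; rewrite scaler0 addr0 mul1r => /eqP.
  by rewrite -subr_eq subrr eq_sym => /eqP.
have Asl v (a : 'I_n -> R) (e : 'I_n -> 'rV[R]_n) :
    A (\sum_i a i *: e i) v = \sum_i a i * A (e i) v.
  by elim/big_rec2: _ => [|i y1 y2 _ IH]; rewrite ?A0l // Al IH.
have Asr u (a : 'I_n -> R) (e : 'I_n -> 'rV[R]_n) :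
    A u (\sum_i a i *: e i) = \sum_i a i * A u (e i).
  by elim/big_rec2: _ => [|i y1 y2 _ IH]; rewrite ?A0r // Ar IH.
have E1 : E *m (G x *m E^T) = 1%:M.
  apply/matrixP => i j; rewrite mulmxA mxE [RHS]mxE -orth /dot mxE.
  apply: eq_bigr => k _; rewrite !mxE; congr (_ * _).
  by apply: eq_bigr => l _; rewrite !mxE.
have G1 : G x *m (E^T *m E) = 1%:M by rewrite mulmxA; exact: mulmx1C.
have Gi : invmx (G x) = E^T *m E.
  have Gu : G x \in unitmx by case: (mulmx1_unit G1).
  by rewrite -[LHS]mulmx1 -G1 mulKmx.
have -> : \sum_i T (cst (row i E)) (cst (row i E)) x =
    \sum_k \sum_i \sum_j (E k i * E k j) * A (delta_mx ord0 i) (delta_mx ord0 j).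
  apply: eq_bigr => k _; rewrite -/(A _ _).
  rewrite [X in A X _]row_sum_delta Asl; apply: eq_bigr => i _.
  rewrite [X in A _ X]row_sum_delta Asr mulr_sumr; apply: eq_bigr => j _.
  by rewrite !mxE mulrA.
rewrite /mtrace [RHS]exchange_big /=; apply: eq_bigr => i _.
rewrite [RHS]exchange_big /=; apply: eq_bigr => j _.
rewrite -mulr_suml Gi mxE; congr (_ * _).
by apply: eq_bigr => k _; rewrite mxE.
Qed.

Lemma christoffel_sym (k i j : 'I_n) x :
  (forall a b c, dmetric a b c x = dmetric a c b x) ->
  christoffel k i j x = christoffel k j i x.
Proof.
move=> sym; congr (_ * _); apply: eq_bigr => l _; congr (_ * _).
by rewrite (sym l i j) [X in X - _ = _]addrC.
Qed.

Lemma christoffel_metric (i j k : 'I_n) x : G x \in unitmx -> (G x)^T = G x ->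
  (forall a b c, dmetric a b c x = dmetric a c b x) ->
  dmetric k i j x = \sum_l (christoffel l k i x * G x l j +
                            christoffel l k j x * G x i l).
Proof.
move=> Gu Gs sym.
have GsE a b : G x a b = G x b a by rewrite -[in LHS]Gs mxE.
have low a b c : \sum_l christoffel l a b x * G x l c =
    2^-1 * (dmetric a b c x + dmetric b a c x - dmetric c a b x).
  under eq_bigr => l _ do rewrite /christoffel -mulrA mulr_suml.
  rewrite -mulr_sumr; congr (_ * _); rewrite exchange_big /=.
  rewrite (bigD1 c)//= [X in _ + X]big1 => [|d dc].
    rewrite addr0; under eq_bigr => l _ do rewrite mulrAC.
    rewrite -mulr_suml.
    have -> : \sum_l invmx (G x) l c * G x l c = (G x *m invmx (G x)) c c.
      by rewrite mxE; apply: eq_bigr => l _; rewrite GsE mulrC.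
    by rewrite mulmxV// mxE eqxx mul1r.
  under eq_bigr => l _ do rewrite mulrAC.
  rewrite -mulr_suml.
  have -> : \sum_l invmx (G x) l d * G x l c = (G x *m invmx (G x)) c d.
    by rewrite mxE; apply: eq_bigr => l _; rewrite GsE mulrC.
  by rewrite mulmxV// mxE eq_sym (negbTE dc) mul0r.
rewrite big_split /= low.
under [X in _ + X]eq_bigr => l _ do rewrite GsE.
rewrite low (sym i k j) (sym j k i) (sym k j i).
by field.
Qed.

End TensorCalculus.

(** * Einstein manifolds

   An identity of tensor fields on M is expressed in every chart, evaluated on
   arbitrary smooth vector fields on the coordinate set (boundary included). *)

Record einstein_manifold (R : realType) (n : nat) (M : smooth_manifold R n)
    (g : riemannian_metric M) (w : M -> R) (lambda m : R) : Prop :=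
  EinsteinManifold {
  einstein_connected : connected [set: M];
  einstein_complete : complete_metric g;
  einstein_smooth : smooth_fun w;
  einstein_eq : forall i X Y, smooth_on (coords i) X -> smooth_on (coords i) Y ->
    forall x, coords i x ->
      Hess (g i) (w \o param i) X Y x =
      w (param i x) / m * (Ric (g i) X Y x - lambda * metric (g i) X Y x);
  einstein_int : forall p, ~ boundary p -> 0 < w p;
  einstein_bnd : forall p, boundary p -> w p = 0
}.

(* Main.v *)
(** The smooth functions on a coordinate set form a commutative ring with n
    commuting derivations, so in a chart every tensor identity becomes a
    polynomial identity over this ring.  Put
    C_abc = nabla_a Ric_bc - nabla_b Ric_ac.  The second Bianchi identity gives
    div R = C and 2 div Ric = d scal, hence
    div Q_abc = (m+1)/m (C_abc + (d_a scal g_bc - d_b scal g_ac) / (2(m-1))).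
    Differentiating the Einstein equation and commuting derivatives of dw
    expresses R(., ., ., grad w) through w C, Ric and dw; the trace of that
    relation is Ric(grad w) = rho dw - w d scal / (2(m-1)).  Together these give
    w div Q + (m+1) Q(., ., ., grad w) = 0, and multiplication by w^m yields the
    claim. *)

Require Import Defs.
From HB Require Import structures.
From mathcomp Require Import all_boot all_order all_algebra.
From mathcomp Require Import ring.
From mathcomp Require Import all_classical all_reals all_analysis.
Import Order.TTheory GRing.Theory Num.Theory.
Import numFieldNormedType.Exports.
Set Implicit Arguments.
Unset Strict Implicit.
Unset Printing Implicit Defensive.
Local Open Scope classical_set_scope.
Local Open Scope ring_scope.

(** Three obstacles shape the proof. The ring of smooth functions is not a field and [w] vanishes on
    the boundary, so the algebra never divides by [w], and inverses of constants enter as elements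
    with an equation. The power w^(m+1) has a real exponent and need not be smooth where w = 0, so
    it is kept out of the ring: since m > 1, its difference quotient at a point still converges to
    (m+1) w^m dw, boundary included, and w^m is then a mere real factor. Finally, class C^k speaks
    only of directional derivatives, and those of a chart are taken inside the half-space; the
    derivation rules, their symmetry and linearity in the direction are proved on open sets by mean
    values and transported through local smooth extensions. The constants are forced. In the trace
    of the relation for R(., ., ., grad w), the form Ric(grad w) occurs on both sides, which turns m
    into m - 1 and produces rho; the coefficient lambda + rho in Q is the one for which all terms
    without a derivative of curvature cancel; and w^(m+1) is the integrating factor of the remaining
    equation. *)

(** * Covariant derivatives of components over a commutative ring with derivations *)

Section ChristoffelCalculus.
Context {S : comPzRingType} {n : nat}.
Variable D : 'I_n -> S -> S.
Hypothesis DD : forall i a b, D i (a + b) = D i a + D i b.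
Hypothesis DM : forall i a b, D i (a * b) = D i a * b + a * D i b.
Hypothesis DC : forall i j a, D i (D j a) = D j (D i a).

Lemma der0 i : D i 0 = 0.
Proof. by apply: (addrI (D i 0)); rewrite -DD !addr0. Qed.

Lemma derN i a : D i (- a) = - D i a.
Proof. by apply/eqP; rewrite -addr_eq0 -DD addNr der0. Qed.

Lemma der1 i : D i 1 = 0.
Proof. by apply: (addrI (D i 1)); rewrite addr0 -[in RHS](mulr1 1) DM mulr1 mul1r. Qed.

Lemma der_sum i (I : Type) (r : seq I) (P : pred I) F :
  D i (\sum_(k <- r | P k) F k) = \sum_(k <- r | P k) D i (F k).
Proof. exact: (big_morph _ (DD i) (der0 i)). Qed.

Lemma der_nat i k : D i k%:R = 0.
Proof. by elim: k => [|k IH]; rewrite ?der0// -natr1 DD IH der1 addr0. Qed.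

(* Gm a is the connection matrix in direction a: Gm a i k is Gamma^k_{ai}, and
   matrices act on row vectors from the right. *)
Variable Gm : 'I_n -> 'M[S]_n.
Hypothesis GmS : forall a b k, Gm a b k = Gm b a k.

(* The Christoffel correction of the covariant derivative in direction e for the
   index a of a covariant tensor. *)
Definition con e a (v : 'I_n -> S) := \sum_k Gm e a k * v k.

Lemma con_ext e a v v' : v =1 v' -> con e a v = con e a v'.
Proof. by move=> E; apply: eq_bigr => k _; rewrite E. Qed.

Lemma conC e a v : con e a v = con a e v.
Proof. by apply: eq_bigr => k _; rewrite GmS. Qed.

Lemma conD e a v v' : con e a (fun k => v k + v' k) = con e a v + con e a v'.
Proof. by rewrite -big_split; apply: eq_bigr => k _; rewrite mulrDr. Qed.

Lemma conN e a v : con e a (fun k => - v k) = - con e a v.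
Proof. by rewrite -sumrN; apply: eq_bigr => k _; rewrite mulrN. Qed.

Lemma conZ e a c v : con e a (fun k => c * v k) = c * con e a v.
Proof. by rewrite mulr_sumr; apply: eq_bigr => k _; rewrite mulrCA. Qed.

Lemma conZr e a c v : con e a (fun k => v k * c) = con e a v * c.
Proof. by rewrite mulr_suml; apply: eq_bigr => k _; rewrite mulrA. Qed.

Definition cov2 e (T : 'I_n -> 'I_n -> S) a b :=
  D e (T a b) - con e a (fun k => T k b) - con e b (fun k => T a k).

Definition cov4 e (T : 'I_n -> 'I_n -> 'I_n -> 'I_n -> S) a b c d :=
  D e (T a b c d) - con e a (fun k => T k b c d) - con e b (fun k => T a k c d)
  - con e c (fun k => T a b k d) - con e d (fun k => T a b c k).

Lemma cov2D e T T' a b :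
  cov2 e (fun a b => T a b + T' a b) a b = cov2 e T a b + cov2 e T' a b.
Proof. by rewrite /cov2 DD !conD; ring. Qed.

Lemma cov2Z e f T a b :
  cov2 e (fun a b => f * T a b) a b = D e f * T a b + f * cov2 e T a b.
Proof. by rewrite /cov2 DM !conZ; ring. Qed.

Lemma cov4D e T T' a b c d :
  cov4 e (fun a b c d => T a b c d + T' a b c d) a b c d =
  cov4 e T a b c d + cov4 e T' a b c d.
Proof. by rewrite /cov4 DD !conD; ring. Qed.

Lemma cov4N e T a b c d :
  cov4 e (fun a b c d => - T a b c d) a b c d = - cov4 e T a b c d.
Proof. by rewrite /cov4 derN !conN; ring. Qed.

Lemma cov4Z e f T a b c d :
  cov4 e (fun a b c d => f * T a b c d) a b c d =
  D e f * T a b c d + f * cov4 e T a b c d.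
Proof. by rewrite /cov4 DM !conZ; ring. Qed.

(** Up to the order of the factors, every term of the product of two symmetric tensors has this
    index pattern or that of [cov4_acbd]. *)
Lemma cov4_adbc e T U a b c d :
  cov4 e (fun a b c d => T a d * U b c) a b c d =
  cov2 e T a d * U b c + T a d * cov2 e U b c.
Proof. by rewrite /cov4 /cov2 DM !conZ !conZr; ring. Qed.

Lemma cov4_acbd e T U a b c d :
  cov4 e (fun a b c d => T a c * U b d) a b c d =
  cov2 e T a c * U b d + T a c * cov2 e U b d.
Proof. by rewrite /cov4 /cov2 DM !conZ !conZr; ring. Qed.

(** * Derivations of matrices, the metric and its contractions *)

Definition dmx e m p (A : 'M[S]_(m, p)) := map_mx (D e) A.

Lemma dmxM e m p q (A : 'M[S]_(m, p)) (B : 'M[S]_(p, q)) :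
  dmx e (A *m B) = dmx e A *m B + A *m dmx e B.
Proof.
apply/matrixP => i j; rewrite !mxE der_sum -big_split.
by apply: eq_bigr => k _; rewrite DM !mxE.
Qed.

Lemma dmxD e m p (A B : 'M[S]_(m, p)) : dmx e (A + B) = dmx e A + dmx e B.
Proof. by apply/matrixP => i j; rewrite !mxE DD. Qed.

Lemma dmxN e m p (A : 'M[S]_(m, p)) : dmx e (- A) = - dmx e A.
Proof. by apply/matrixP => i j; rewrite !mxE derN. Qed.

Lemma dmxC e f m p (A : 'M[S]_(m, p)) : dmx e (dmx f A) = dmx f (dmx e A).
Proof. by apply/matrixP => i j; rewrite !mxE DC. Qed.

Lemma dmx_trmx e m p (A : 'M[S]_(m, p)) : dmx e A^T = (dmx e A)^T.
Proof. by apply/matrixP => i j; rewrite !mxE. Qed.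

Lemma dmx1 e : dmx e (1%:M : 'M[S]_n) = 0.
Proof. by apply/matrixP => i j; rewrite !mxE der_nat. Qed.

Variables g gi : 'M[S]_n.
Hypothesis gS : g^T = g.
Hypothesis ggi : g *m gi = 1%:M.
Hypothesis Dg : forall e, dmx e g = Gm e *m g + g *m (Gm e)^T.

Lemma gig : gi *m g = 1%:M. Proof. exact: mulmx1C. Qed.

Lemma giS : gi^T = gi.
Proof. by rewrite -[LHS]mulmx1 -ggi -{1}gS mulmxA -trmx_mul ggi trmx1 mul1mx. Qed.

(** Differentiate [gi *m g = 1] and multiply by [gi] on the right. *)
Lemma der_gi e : dmx e gi = - (gi *m Gm e + (Gm e)^T *m gi).
Proof.
have : dmx e gi *m g + gi *m dmx e g = 0 by rewrite -dmxM gig dmx1.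
move/eqP; rewrite addr_eq0 => /eqP /(congr1 (mulmx^~ gi)).
rewrite -mulmxA ggi mulmx1 => ->; rewrite mulNmx Dg mulmxDr mulmxDl !mulmxA.
by rewrite gig mul1mx -(mulmxA _ g gi) ggi mulmx1.
Qed.

Lemma cov2_metric e a b : cov2 e g a b = 0.
Proof.
have E : D e (g a b) = dmx e g a b by rewrite mxE.
rewrite /cov2 E Dg !mxE /con.
have -> : \sum_j g a j * (Gm e)^T j b = \sum_k Gm e b k * g a k.
  by apply: eq_bigr => k _; rewrite mxE mulrC.
ring.
Qed.

Definition tr2 (T : 'I_n -> 'I_n -> S) := \sum_a \sum_b gi a b * T a b.

Lemma tr2_ext T T' : (forall a b, T a b = T' a b) -> tr2 T = tr2 T'.
Proof. by move=> E; do 2!apply: eq_bigr => ? _; rewrite E. Qed.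

Lemma tr2D T T' : tr2 (fun a b => T a b + T' a b) = tr2 T + tr2 T'.
Proof.
rewrite -big_split; apply: eq_bigr => a _; rewrite -big_split.
by apply: eq_bigr => b _; rewrite mulrDr.
Qed.

Lemma tr2N T : tr2 (fun a b => - T a b) = - tr2 T.
Proof.
by rewrite -sumrN; apply: eq_bigr => a _; rewrite -sumrN; apply: eq_bigr => b _;
  rewrite mulrN.
Qed.

Lemma tr2Z c T : tr2 (fun a b => c * T a b) = c * tr2 T.
Proof.
rewrite mulr_sumr; apply: eq_bigr => a _; rewrite mulr_sumr.
by apply: eq_bigr => b _; rewrite mulrCA.
Qed.

Lemma tr2C T : tr2 (fun a b => T b a) = tr2 T.
Proof.
rewrite /tr2 exchange_big; do 2!apply: eq_bigr => ? _.
by rewrite -[in LHS]giS mxE.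
Qed.

Lemma tr2_sum (I : finType) (T : I -> 'I_n -> 'I_n -> S) :
  tr2 (fun a b => \sum_k T k a b) = \sum_k tr2 (T k).
Proof.
rewrite exchange_big; apply: eq_bigr => a _; rewrite exchange_big.
by apply: eq_bigr => b _; rewrite mulr_sumr.
Qed.

(** Double contractions computed in both orders yield the contracted Bianchi identity and the
    formula for Ric(grad w). *)
Lemma tr2_exchange (T : 'I_n -> 'I_n -> 'I_n -> 'I_n -> S) :
  tr2 (fun a b => tr2 (T a b)) = tr2 (fun c d => tr2 (fun a b => T a b c d)).
Proof.
rewrite [LHS]/tr2; under eq_bigr do under eq_bigr do rewrite -tr2Z.
under eq_bigr do rewrite -tr2_sum; rewrite -tr2_sum; apply: tr2_ext => c d.
by [].
Qed.

Lemma tr2_metric_l c (v : 'I_n -> S) : tr2 (fun a b => g a c * v b) = v c.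
Proof.
rewrite -tr2C /tr2; transitivity (\sum_a (gi *m g) a c * v a); last first.
  rewrite gig (bigD1 c)//= mxE eqxx mul1r big1 ?addr0// => k /negbTE kc.
  by rewrite mxE kc mul0r.
by apply: eq_bigr => a _; rewrite mxE mulr_suml; apply: eq_bigr => b _; rewrite mulrA.
Qed.

Lemma tr2_metric : tr2 (fun a b => g a b) = n%:R.
Proof.
transitivity (\tr (gi *m g)); last by rewrite gig mxtrace1.
by apply: eq_bigr => a _; rewrite mxE; apply: eq_bigr => b _; rewrite -[in LHS]gS mxE.
Qed.

(** The derivative of the inverse metric supplies exactly the two Christoffel corrections of [cov2],
    one from each summand of [der_gi]. *)
Lemma der_tr2 e T : D e (tr2 T) = tr2 (cov2 e T).
Proof.
have -> : tr2 (cov2 e T) = tr2 (fun a b => D e (T a b)) +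
    - tr2 (fun a b => con e a (T^~ b)) + - tr2 (fun a b => con e b (T a)).
  by rewrite -!tr2N -!tr2D; apply: tr2_ext => a b.
have -> : D e (tr2 T) = tr2 (fun a b => D e (T a b)) +
    \sum_a \sum_b dmx e gi a b * T a b.
  rewrite der_sum -big_split; apply: eq_bigr => a _; rewrite der_sum -big_split.
  by apply: eq_bigr => b _; rewrite DM mxE addrC.
rewrite -addrA; congr (_ + _); rewrite der_gi -opprD.
under eq_bigr => a _ do under eq_bigr => b _ do rewrite !mxE mulNr mulrDl.
under eq_bigr => a _ do rewrite sumrN big_split.
rewrite sumrN big_split /=; congr (- _); rewrite addrC; congr (_ + _).
- rewrite [RHS]exchange_big [LHS]exchange_big /=; apply: eq_bigr => b _.
  under eq_bigr => a _ do rewrite mulr_suml.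
  rewrite exchange_big /=; apply: eq_bigr => a _; rewrite mulr_sumr.
  by apply: eq_bigr => k _; rewrite mxE; ring.
- apply: eq_bigr => a _; under eq_bigr => b _ do rewrite mulr_suml.
  rewrite exchange_big /=; apply: eq_bigr => b _; rewrite mulr_sumr.
  by apply: eq_bigr => k _; ring.
Qed.

Lemma con_tr2 e a (T : 'I_n -> 'I_n -> 'I_n -> S) :
  con e a (fun k => tr2 (T k)) = tr2 (fun b c => con e a (fun k => T k b c)).
Proof. by rewrite tr2_sum; apply: eq_bigr => k _; rewrite tr2Z. Qed.

Lemma cov2_tr4 e (T : 'I_n -> 'I_n -> 'I_n -> 'I_n -> S) a d :
  cov2 e (fun a d => tr2 (fun b c => T a b c d)) a d =
  tr2 (fun b c => cov4 e T a b c d).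
Proof.
rewrite /cov2 der_tr2 !con_tr2 -!tr2N -!tr2D; apply: tr2_ext => b c.
rewrite /cov2 /cov4; ring.
Qed.

(** * Curvature and the Bianchi identities *)

(** Connection matrices act on row vectors from the right, so the products stand in the order
    opposite to the usual one; [nabE_comm] confirms that this is the commutator of covariant
    derivatives. *)
Definition curv a b :=
  dmx a (Gm b) - dmx b (Gm a) + Gm b *m Gm a - Gm a *m Gm b.

Definition Rd a b c d := (curv a b *m g) c d.

Lemma addmxE m p (A B : 'M[S]_(m, p)) i j : (A + B) i j = A i j + B i j.
Proof. by rewrite mxE. Qed.

Lemma oppmxE m p (A : 'M[S]_(m, p)) i j : (- A) i j = - A i j.
Proof. by rewrite mxE. Qed.

Definition mxlin := (mulmxDl, mulmxDr, mulNmx, mulmxN, mulmxA, addmxE, oppmxE).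

Lemma curvN a b : curv b a = - curv a b.
Proof. by apply/matrixP => i j; rewrite /curv !mxlin; ring. Qed.

Lemma Rd_anti12 a b c d : Rd b a c d = - Rd a b c d.
Proof. by rewrite /Rd curvN mulNmx oppmxE. Qed.

(** Second derivatives of the metric commute. Expanding both orders by [Dg], the mixed products
    cancel and what remains is the symmetric part of [curv a b *m g]. *)
Lemma curv_anti a b : curv a b *m g = - (curv a b *m g)^T.
Proof.
have E e f : dmx e (dmx f g) = dmx e (Gm f) *m g +
    Gm f *m (Gm e *m g + g *m (Gm e)^T) + (Gm e *m g + g *m (Gm e)^T) *m (Gm f)^T
    + g *m (dmx e (Gm f))^T.
  by rewrite [dmx f g]Dg dmxD !dmxM !Dg dmx_trmx !addrA.
have /matrixP := dmxC a b g; rewrite !E => E'.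
rewrite trmx_mul gS /curv !(linearB, linearD) /= !trmx_mul.
apply/matrixP => i j; have /eqP := E' i j; rewrite -subr_eq0 => /eqP {}E'.
apply/eqP; rewrite -subr_eq0; apply/eqP; rewrite -E' !mxlin; ring.
Qed.

Lemma Rd_anti34 a b c d : Rd a b d c = - Rd a b c d.
Proof. by rewrite /Rd [in LHS]curv_anti !mxE. Qed.

(** Each summand is a derivative of the curvature corrected only in its endomorphism indices. Second
    derivatives of the connection cancel because derivations commute, and the cubic terms by the
    Jacobi identity. *)
Lemma curv_bianchi a b e :
  (dmx e (curv a b) - Gm e *m curv a b + curv a b *m Gm e) +
  (dmx a (curv b e) - Gm a *m curv b e + curv b e *m Gm a) +
  (dmx b (curv e a) - Gm b *m curv e a + curv e a *m Gm b) = 0.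
Proof.
rewrite /curv !(dmxD, dmxN, dmxM) [dmx e (dmx a _)]dmxC [dmx e (dmx b _)]dmxC.
rewrite [dmx a (dmx b _)]dmxC.
by apply/matrixP => i j; rewrite !mxlin [RHS]mxE; ring.
Qed.

(** Lowering the last index costs a derivative of [g], which [Dg] trades for the correction at [d].
    What is left is a summand of [curv_bianchi] together with the corrections at [a] and [b]. *)
Lemma cov4_Rd e a b c d :
  cov4 e Rd a b c d =
  ((dmx e (curv a b) - Gm e *m curv a b + curv a b *m Gm e) *m g) c d
  - con e a (fun k => Rd k b c d) - con e b (fun k => Rd a k c d).
Proof.
have D1 : D e (Rd a b c d) = (dmx e (curv a b) *m g
    + curv a b *m (Gm e *m g + g *m (Gm e)^T)) c d.
  by rewrite -Dg -dmxM mxE.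
have C1 : con e c (fun k => Rd a b k d) = (Gm e *m curv a b *m g) c d.
  by rewrite -mulmxA [RHS]mxE.
have C2 : con e d (fun k => Rd a b c k) = (curv a b *m g *m (Gm e)^T) c d.
  by rewrite [RHS]mxE; apply: eq_bigr => k _; rewrite [X in _ = _ * X]mxE mulrC.
by rewrite /cov4 D1 C1 C2 !mxlin; ring.
Qed.

Lemma bianchi2 e a b c d :
  cov4 e Rd a b c d + cov4 a Rd b e c d + cov4 b Rd e a c d = 0.
Proof.
(* Symmetry of the Christoffel symbols and antisymmetry of the curvature in its first pair: the six
   corrections at the form indices cancel in pairs over the cyclic sum. *)
have A x y z : con x y (fun k => Rd z k c d) = - con y x (fun k => Rd k z c d).
  rewrite conC -conN; apply: con_ext => k; exact: Rd_anti12.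
have /matrixP/(_ c d) := congr1 (mulmx^~ g) (curv_bianchi a b e).
rewrite mul0mx [RHS]mxE (mulmxDl _ _ g) (mulmxDl _ _ g) !addmxE !cov4_Rd => E.
by rewrite (A e b) (A a e) (A b a) -[RHS]E; ring.
Qed.

Definition Rc a d := tr2 (fun b c => Rd a b c d).
Definition sc := tr2 Rc.

Lemma cov4_ext e T T' a b c d : (forall a b c d, T a b c d = T' a b c d) ->
  cov4 e T a b c d = cov4 e T' a b c d.
Proof.
by move=> E; rewrite /cov4 E; congr (_ - _ - _ - _ - _); apply: con_ext => k.
Qed.

Lemma cov2_ext e T T' a b : (forall a b, T a b = T' a b) ->
  cov2 e T a b = cov2 e T' a b.
Proof. by move=> E; rewrite /cov2 E; congr (_ - _ - _); apply: con_ext => k. Qed.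

Lemma cov4_Rd34 e a b c d : cov4 e Rd a b d c = - cov4 e Rd a b c d.
Proof.
have -> : cov4 e Rd a b d c = cov4 e (fun a b c d => Rd a b d c) a b c d.
  by rewrite /cov4; ring.
by rewrite -cov4N; apply: cov4_ext => *; exact: Rd_anti34.
Qed.

Lemma cov4_Rd12 e a b c d : cov4 e Rd b a c d = - cov4 e Rd a b c d.
Proof.
have -> : cov4 e Rd b a c d = cov4 e (fun a b c d => Rd b a c d) a b c d.
  by rewrite /cov4; ring.
by rewrite -cov4N; apply: cov4_ext => *; exact: Rd_anti12.
Qed.

Lemma cov2_Rc e a d : cov2 e Rc a d = tr2 (fun b c => cov4 e Rd a b c d).
Proof. exact: cov2_tr4. Qed.

(** Contract the second Bianchi identity over [e] and [d]; the antisymmetries bring the two other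
    terms to the slots that define [Rc]. *)
Lemma div_Rd a b c :
  tr2 (fun e d => cov4 e Rd a b c d) = cov2 a Rc b c - cov2 b Rc a c.
Proof.
rewrite !cov2_Rc -tr2N -tr2D; apply: tr2_ext => e d.
have := bianchi2 e a b c d.
rewrite (cov4_Rd34 a) (cov4_Rd34 b) (cov4_Rd12 b) => E.
by rewrite -[RHS]addr0 -E; ring.
Qed.

Definition dvRc a := tr2 (fun e d => cov2 e Rc a d).

(** The double trace of the derivative of the curvature is [dvRc a] in one order and, by [div_Rd],
    [D a sc - dvRc a] in the other. *)
Lemma div_Rc a : dvRc a + dvRc a = D a sc.
Proof.
have L : tr2 (fun b c => tr2 (fun e d => cov4 e Rd a b c d)) = dvRc a.
  by rewrite tr2_exchange; apply: tr2_ext => e d; rewrite cov2_Rc.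
have : tr2 (fun b c => tr2 (fun e d => cov4 e Rd a b c d)) = D a sc - dvRc a.
  by under tr2_ext do rewrite div_Rd; rewrite tr2D tr2N -der_tr2.
by rewrite L => {1}->; rewrite subrK.
Qed.

Lemma tr2_metric_r a (v : 'I_n -> S) : tr2 (fun e d => v e * g a d) = v a.
Proof.
rewrite -tr2C -[RHS]tr2_metric_l; apply: tr2_ext => e d.
by rewrite mulrC -[in LHS]gS mxE.
Qed.

(** * Derivatives of [w] and the Einstein equation *)

Variable w : S.

Definition hess b c := D b (D c w) - con b c (fun k => D k w).

(** Commuting two covariant derivatives of the one-form dw gives minus the curvature applied to dw;
    the trace on the right is R(a, b, c, grad w). *)
Lemma ricci_identity a b c :
  cov2 a hess b c - cov2 b hess a c = - tr2 (fun e d => D e w * Rd a b c d).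
Proof.
pose u : 'cV[S]_n := \col_k D k w.
have H e : (fun k => hess e k) =1 (fun k => (dmx e u - Gm e *m u) k ord0).
  move=> k; rewrite !mxE /hess /con; congr (_ - _).
  by apply: eq_bigr => j _; rewrite mxE.
(* The correction at the index [f] is symmetric in [e] and [f], so it drops out of the difference;
   the matrix part is the iterated connection on the column of derivatives of [w]. *)
have C2 e f k : cov2 e hess f k = - con e f (fun j => hess j k) +
    (dmx e (dmx f u) - dmx e (Gm f) *m u - Gm f *m dmx e u
     - Gm e *m dmx f u + Gm e *m Gm f *m u) k ord0.
  have -> : dmx e (dmx f u) - dmx e (Gm f) *m u - Gm f *m dmx e u
     - Gm e *m dmx f u + Gm e *m Gm f *m u =
     dmx e (dmx f u - Gm f *m u) - Gm e *m (dmx f u - Gm f *m u).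
    rewrite dmxD dmxN dmxM; apply/matrixP => i j; rewrite !mxlin; ring.
  have DE : D e ((dmx f u - Gm f *m u) k ord0) =
      dmx e (dmx f u - Gm f *m u) k ord0 by rewrite [RHS]mxE.
  have ME : (Gm e *m (dmx f u - Gm f *m u)) k ord0 =
      con e k (fun j => (dmx f u - Gm f *m u) j ord0) by rewrite [LHS]mxE.
  rewrite /cov2 (H f k) (con_ext _ _ (H f)).
  by rewrite (addmxE (dmx e _)) oppmxE ME -DE; ring.
rewrite !C2 (conC b a) (dmxC b a).
have -> : tr2 (fun e d => D e w * Rd a b c d) = (curv a b *m u) c ord0.
  have -> : curv a b *m u = curv a b *m g *m (gi *m u).
    by rewrite mulmxA -(mulmxA _ g) ggi mulmx1.
  rewrite [RHS]mxE -tr2C; apply: eq_bigr => d _.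
  rewrite [X in _ = _ * X]mxE mulr_sumr; apply: eq_bigr => e _.
  by rewrite [u _ _]mxE -/(Rd a b c d); ring.
rewrite /curv !mxlin; ring.
Qed.

(* mi, m1i and h stand for 1/m, 1/(m-1) and 1/2: S need not be a field. *)
Variables m mi m1i h lam : S.
Hypothesis mmi : m * mi = 1.
Hypothesis m1m1i : (m - 1) * m1i = 1.
Hypothesis hh : 2 * h = 1.
Hypothesis Dmi : forall e, D e mi = 0.
Hypothesis Dm1i : forall e, D e m1i = 0.
Hypothesis Dlam : forall e, D e lam = 0.
Hypothesis einstein : forall b c, hess b c = w * mi * (Rc b c - lam * g b c).

Definition rhod := m1i * ((n%:R - 1) * lam - sc).

Definition odt (s r : 'I_n -> 'I_n -> S) a b c d :=
  h * (r a d * s b c + r b c * s a d - r a c * s b d - r b d * s a c).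

Definition Qd a b c d := Rd a b c d + 2 * mi * odt Rc g a b c d
  - (lam + rhod) * mi * odt g g a b c d.

(** With [h] eliminated and differences written as sums of opposites, the linearity lemmas for
    [cov4] and [tr2] apply by rewriting. *)
Lemma QdE a b c d : Qd a b c d = Rd a b c d
  + mi * (g a d * Rc b c + g b c * Rc a d + - (g a c * Rc b d) + - (g b d * Rc a c))
  + - ((lam + rhod) * mi) * (g a d * g b c + - (g a c * g b d)).
Proof.
transitivity (Rd a b c d + (2 * h) * mi *
    (g a d * Rc b c + g b c * Rc a d + - (g a c * Rc b d) + - (g b d * Rc a c))
  + - ((2 * h) * ((lam + rhod) * mi)) * (g a d * g b c + - (g a c * g b d))).
  by rewrite /Qd /odt; ring.
by rewrite hh; ring.
Qed.

(** The one-form Ric(grad w). *)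
Let v a := tr2 (fun e d => D e w * Rc a d).

Lemma grad_Rd a b c : tr2 (fun e d => D e w * Rd a b c d) =
  - (w * mi * (cov2 a Rc b c - cov2 b Rc a c)
     + mi * (D a w * (Rc b c - lam * g b c) - D b w * (Rc a c - lam * g a c))).
Proof.
have E a' b' c' : cov2 a' hess b' c' = D a' w * mi * (Rc b' c' - lam * g b' c')
    + w * mi * cov2 a' Rc b' c'.
  rewrite (cov2_ext a' b' c' einstein).
  have -> : cov2 a' (fun b c => w * mi * (Rc b c - lam * g b c)) b' c' =
      cov2 a' (fun b c => w * mi * (Rc b c + - lam * g b c)) b' c'.
    by apply: cov2_ext => ? ?; ring.
  rewrite (cov2Z a' (w * mi)) cov2D (cov2Z a' (- lam)) cov2_metric.
  by rewrite DM Dmi derN Dlam; ring.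
by rewrite -[LHS]opprK -ricci_identity !E; ring.
Qed.

Lemma tr2_grad_Rd a :
  tr2 (fun b c => tr2 (fun e d => D e w * Rd a b c d)) = v a.
Proof. by rewrite tr2_exchange; apply: tr2_ext => e d; rewrite tr2Z. Qed.

Lemma dvRcE a : dvRc a = h * D a sc.
Proof. by rewrite -div_Rc -[LHS]mul1r -hh; ring. Qed.

Lemma grad_Rc a :
  v a = m1i * (- (w * h * D a sc + D a w * (sc - (n%:R - 1) * lam))).
Proof.
have E : v a = - mi * (w * (D a sc - dvRc a)
    + D a w * (sc - lam * n%:R) - v a + lam * D a w).
  rewrite -[LHS]tr2_grad_Rd.
  have -> : tr2 (fun b c => tr2 (fun e d => D e w * Rd a b c d)) = tr2 (fun b c =>
      (- (w * mi)) * cov2 a Rc b c + (w * mi) * cov2 b Rc a c +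
      (- (mi * D a w)) * Rc b c + (mi * D a w * lam) * g b c +
      mi * (D b w * Rc a c) + (- (mi * lam)) * (D b w * g a c)).
    by apply: tr2_ext => b c; rewrite grad_Rd; ring.
  by rewrite !tr2D !tr2Z -der_tr2 tr2_metric tr2_metric_r -/(dvRc a) -/(v a) -/sc; ring.
(* One copy of [v a] comes back from the trace of [D b w * Rc a c]; moving it to the left turns the
   factor [m] into [m - 1]. *)
have {}E : (m - 1) * v a = - (w * h * D a sc + D a w * (sc - (n%:R - 1) * lam)).
  have mE : m * v a = - (w * (D a sc - dvRc a)
    + D a w * (sc - lam * n%:R) - v a + lam * D a w).
    by rewrite {1}E mulrA mulrN mmi; ring.
  have dE : D a sc - dvRc a = h * D a sc by rewrite -{1}div_Rc addrK dvRcE.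
  by rewrite mulrBl mE dE; ring.
by rewrite -E mulrA [m1i * _]mulrC m1m1i mul1r.
Qed.

(** In the coefficient [mi * (h + m1i)], which is (m+1)/(2m(m-1)), [h] comes from the divergence of
    Ric and [m1i] from the derivative of rho. *)
Lemma div_Qd a b c : tr2 (fun e d => cov4 e Qd a b c d) =
  (1 + mi) * (cov2 a Rc b c - cov2 b Rc a c)
  + mi * (h + m1i) * (D a sc * g b c - D b sc * g a c).
Proof.
have E e d : cov4 e Qd a b c d = cov4 e Rd a b c d
    + mi * (cov2 e Rc b c * g a d + g b c * cov2 e Rc a d
            + - (g a c * cov2 e Rc b d) + - (cov2 e Rc a c * g b d))
    + m1i * mi * (g b c * (D e sc * g a d) + - (g a c * (D e sc * g b d))).
  rewrite (cov4_ext _ _ _ _ _ QdE) !cov4D !(cov4Z e) Dmi.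
  rewrite !cov4D !cov4N !(cov4_adbc, cov4_acbd).
  have adbc' T U : cov4 e (fun a b c d => T b c * U a d) a b c d =
      cov2 e T b c * U a d + T b c * cov2 e U a d.
    rewrite (@cov4_ext e _ (fun a b c d => U a d * T b c)) ?cov4_adbc; first by ring.
    by move=> *; rewrite mulrC.
  have acbd' T U : cov4 e (fun a b c d => T b d * U a c) a b c d =
      cov2 e T b d * U a c + T b d * cov2 e U a c.
    rewrite (@cov4_ext e _ (fun a b c d => U a c * T b d)) ?cov4_acbd; first by ring.
    by move=> *; rewrite mulrC.
  rewrite !adbc' !acbd' !cov2_metric derN DM Dmi DD Dlam DM Dm1i DD derN DM.
  by rewrite Dlam DD derN der1 der_nat; ring.
rewrite (tr2_ext E) 2!tr2D div_Rd !tr2Z !tr2D !tr2N !tr2Z.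
rewrite !tr2_metric_r -!/(dvRc _) !dvRcE; ring.
Qed.

(* The equation w div Q + (m+1) Q(., ., ., grad w) = 0 involves no division by w,
   so that it makes sense on the boundary. *)
Lemma div_grad_Q a b c :
  w * tr2 (fun e d => cov4 e Qd a b c d)
  + (m + 1) * tr2 (fun e d => D e w * Qd a b c d) = 0.
Proof.
have -> : tr2 (fun e d => D e w * Qd a b c d) =
    tr2 (fun e d => D e w * Rd a b c d)
    + mi * (Rc b c * D a w + g b c * v a - g a c * v b - Rc a c * D b w)
    - (lam + rhod) * mi * (g b c * D a w - g a c * D b w).
  have E e d : D e w * Qd a b c d = D e w * Rd a b c d
      + mi * (Rc b c * (D e w * g a d) + g b c * (D e w * Rc a d)
              + - g a c * (D e w * Rc b d) + - Rc a c * (D e w * g b d))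
      + - ((lam + rhod) * mi) * (g b c * (D e w * g a d) + - g a c * (D e w * g b d)).
    by rewrite QdE; ring.
  by rewrite (tr2_ext E) 2!tr2D !tr2Z !tr2D !tr2Z !tr2_metric_r /v; ring.
rewrite div_Qd grad_Rd !grad_Rc /rhod.
set C := cov2 a _ _ _ - _; set sa := D a sc; set sb := D b sc.
(* The terms in dw without a derivative of curvature cancel identically. The rest is written through
   the defects of the three relations for [mi], [m1i] and [h], all of which are zero. *)
transitivity ((1 - m * mi) * (w * C) + mi * w *
    (h * (1 - (m - 1) * m1i) + m1i * (1 - 2 * h)) * (sa * g b c - sb * g a c)).
  by ring.
by rewrite mmi m1m1i hh; ring.
Qed.


End ChristoffelCalculus.

(** * From components to arbitrary vector fields *)

Section TensorFields.
Context {S : comPzRingType} {n : nat}.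
Variable D : 'I_n -> S -> S.
Hypothesis DD : forall i a b, D i (a + b) = D i a + D i b.
Hypothesis DM : forall i a b, D i (a * b) = D i a * b + a * D i b.
Hypothesis DC : forall i j a, D i (D j a) = D j (D i a).
Variable Gm : 'I_n -> 'M[S]_n.
Implicit Types (X Y Z W U : 'rV[S]_n) (F : 'I_n -> S).

Local Notation con := (con Gm).

Definition ct X F := \sum_a X ord0 a * F a.

Lemma ct_ext X F F' : (forall a, F a = F' a) -> ct X F = ct X F'.
Proof. by move=> E; apply: eq_bigr => a _; rewrite E. Qed.

Lemma ctD X F F' : ct X (fun a => F a + F' a) = ct X F + ct X F'.
Proof. by rewrite -big_split; apply: eq_bigr => a _; rewrite mulrDr. Qed.

Lemma ctN X F : ct X (fun a => - F a) = - ct X F.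
Proof. by rewrite -sumrN; apply: eq_bigr => a _; rewrite mulrN. Qed.

Lemma ctZ X c F : ct X (fun a => c * F a) = c * ct X F.
Proof. by rewrite mulr_sumr; apply: eq_bigr => a _; rewrite mulrCA. Qed.

Lemma ct_sum X (I : finType) (F : I -> 'I_n -> S) :
  ct X (fun a => \sum_k F k a) = \sum_k ct X (F k).
Proof. by rewrite exchange_big; apply: eq_bigr => a _; rewrite mulr_sumr. Qed.

Lemma ct_suml (I : finType) (c : I -> S) (X : I -> 'rV[S]_n) F :
  ct (\sum_k c k *: X k) F = \sum_k c k * ct (X k) F.
Proof.
under [RHS]eq_bigr do rewrite mulr_sumr.
rewrite exchange_big; apply: eq_bigr => a _; rewrite summxE mulr_suml.
by apply: eq_bigr => k _; rewrite mxE mulrA.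
Qed.

(** Carries linearity in an inner slot through an outer contraction; [phi] is the inner expression
    as a function of the field in that slot. *)
Lemma ct_suml2 X (I : finType) (c : I -> S) (V : I -> 'rV[S]_n)
    (phi : 'rV[S]_n -> 'I_n -> S) :
  (forall a, phi (\sum_k c k *: V k) a = \sum_k c k * phi (V k) a) ->
  ct X (phi (\sum_k c k *: V k)) = \sum_k c k * ct X (phi (V k)).
Proof.
by move=> E; rewrite (ct_ext _ E) ct_sum; apply: eq_bigr => k _; rewrite ctZ.
Qed.

Lemma con_ct e a Y (T : 'I_n -> 'I_n -> S) :
  con e a (fun k => ct Y (T k)) = ct Y (fun b => con e a (T^~ b)).
Proof. by rewrite ct_sum; apply: eq_bigr => k _; rewrite ctZ. Qed.

Lemma con_ct2 e a Y Z (T : 'I_n -> 'I_n -> 'I_n -> S) :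
  con e a (fun k => ct Y (fun b => ct Z (T k b))) =
  ct Y (fun b => ct Z (fun c => con e a (fun k => T k b c))).
Proof. by rewrite con_ct; apply: ct_ext => b; rewrite con_ct. Qed.

Lemma con_ct3 e a Y Z W (T : 'I_n -> 'I_n -> 'I_n -> 'I_n -> S) :
  con e a (fun k => ct Y (fun b => ct Z (fun c => ct W (T k b c)))) =
  ct Y (fun b => ct Z (fun c => ct W (fun d => con e a (fun k => T k b c d)))).
Proof. by rewrite con_ct; apply: ct_ext => b; rewrite con_ct2. Qed.

Definition nabE e X := dmx D e X + X *m Gm e.

Lemma der_ct e X F :
  D e (ct X F) = ct (nabE e X) F + ct X (fun a => D e (F a) - con e a F).
Proof.
rewrite ctD ctN der_sum//.
have -> : ct (nabE e X) F = \sum_a D e (X ord0 a) * F a + ct X (fun a => con e a F).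
  under [ct X _]eq_bigr do rewrite mulr_sumr.
  rewrite exchange_big -big_split; apply: eq_bigr => a _.
  rewrite !mxE mulrDl mulr_suml; congr (_ + _).
  by apply: eq_bigr => k _; rewrite mulrA.
rewrite addrACA subrr addr0 -big_split; apply: eq_bigr => a _; exact: DM.
Qed.

(* The multilinear extension of the components T to vector fields. *)
Definition ev4 (T : 'I_n -> 'I_n -> 'I_n -> 'I_n -> S) X Y Z W :=
  ct X (fun a => ct Y (fun b => ct Z (fun c => ct W (T a b c)))).

Lemma der_ev4 e T X Y Z W : D e (ev4 T X Y Z W) =
  ev4 T (nabE e X) Y Z W + ev4 T X (nabE e Y) Z W + ev4 T X Y (nabE e Z) W
  + ev4 T X Y Z (nabE e W) + ev4 (cov4 D Gm e T) X Y Z W.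
Proof.
rewrite /ev4 der_ct -!addrA; congr (_ + _); rewrite -!ctD; apply: ct_ext => a.
rewrite con_ct3 der_ct -!addrA; congr (_ + _); rewrite -!ctN -!ctD.
apply: ct_ext => b.
rewrite con_ct2 der_ct -!addrA; congr (_ + _); rewrite -!ctN -!ctD.
apply: ct_ext => c.
rewrite con_ct der_ct -!addrA; congr (_ + _); rewrite -!ctN -!ctD.
by apply: ct_ext => d; rewrite /cov4; ring.
Qed.

Definition derU U f := ct U (D^~ f).

Definition nab X Y := \sum_a X ord0 a *: nabE a Y.

(** Tensoriality of the covariant derivative: by the Leibniz rule, the derivatives of the argument
    fields are exactly those subtracted on the left. *)
Lemma derU_ev4 U T X Y Z W : derU U (ev4 T X Y Z W) - ev4 T (nab U X) Y Z W
  - ev4 T X (nab U Y) Z W - ev4 T X Y (nab U Z) W - ev4 T X Y Z (nab U W) =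
  ct U (fun e => ev4 (cov4 D Gm e T) X Y Z W).
Proof.
have -> : ct U (fun e => ev4 (cov4 D Gm e T) X Y Z W) =
    ct U (fun e => D e (ev4 T X Y Z W) + - ev4 T (nabE e X) Y Z W
    + - ev4 T X (nabE e Y) Z W + - ev4 T X Y (nabE e Z) W
    + - ev4 T X Y Z (nabE e W)).
  by apply: ct_ext => e; rewrite der_ev4; ring.
rewrite !ctD !ctN; rewrite /ev4 /nab.
congr (_ - _ - _ - _ - _); first exact: ct_suml.
- by apply: (@ct_suml2 _ _ _ _ (fun V a => ct V _)) => a; exact: ct_suml.
- apply: (@ct_suml2 _ _ _ _ (fun V a => ct Y (fun b => ct V _))) => a.
  by apply: (@ct_suml2 _ _ _ _ (fun V b => ct V _)) => b; exact: ct_suml.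
- apply: (@ct_suml2 _ _ _ _ (fun V a => ct Y (fun b => ct Z (fun c => ct V _)))) => a.
  apply: (@ct_suml2 _ _ _ _ (fun V b => ct Z (fun c => ct V _))) => b.
  by apply: (@ct_suml2 _ _ _ _ (fun V c => ct V _)) => c; exact: ct_suml.
Qed.

Lemma nabED e X Y : nabE e (X + Y) = nabE e X + nabE e Y.
Proof. by rewrite /nabE dmxD// mulmxDl addrACA. Qed.

Lemma nabE_sum e (I : finType) (X : I -> 'rV[S]_n) :
  nabE e (\sum_k X k) = \sum_k nabE e (X k).
Proof.
apply: (big_morph _ (nabED e)); rewrite /nabE mul0mx addr0.
by apply/matrixP => i j; rewrite !mxE der0.
Qed.

Lemma nabEZ e c X : nabE e (c *: X) = D e c *: X + c *: nabE e X.
Proof.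
rewrite /nabE scalerDr -scalemxAl addrA; congr (_ + _).
by apply/matrixP => i j; rewrite !mxE DM.
Qed.

Lemma nabE_comm a b Z : nabE a (nabE b Z) - nabE b (nabE a Z) = Z *m curv D Gm a b.
Proof.
rewrite /nabE /curv !(dmxD, dmxM)// (dmxC DC b a).
by apply/matrixP => i j; rewrite !mxlin; ring.
Qed.

Definition lieb X Y := \row_b (derU X (Y ord0 b) - derU Y (X ord0 b)).

Lemma nab_nab X Y Z : nab X (nab Y Z) = \sum_b derU X (Y ord0 b) *: nabE b Z
  + \sum_a \sum_b (X ord0 a * Y ord0 b) *: nabE a (nabE b Z).
Proof.
under [X in X + _]eq_bigr do rewrite scaler_suml.
rewrite exchange_big -big_split; apply: eq_bigr => a _.
rewrite nabE_sum scaler_sumr -big_split; apply: eq_bigr => b _.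
by rewrite nabEZ scalerDr !scalerA.
Qed.

Definition curvf X Y Z := nab X (nab Y Z) - nab Y (nab X Z) - nab (lieb X Y) Z.

(** Tensoriality of the curvature: the terms that differentiate the components of [X] and [Y] form
    the bracket term, and those that differentiate [Z] cancel by [nabE_comm]. *)
Lemma curvfE X Y Z :
  curvf X Y Z = \sum_a \sum_b (X ord0 a * Y ord0 b) *: (Z *m curv D Gm a b).
Proof.
rewrite /curvf.
have -> : nab (lieb X Y) Z = \sum_b derU X (Y ord0 b) *: nabE b Z
    - \sum_b derU Y (X ord0 b) *: nabE b Z.
  by rewrite -sumrB; apply: eq_bigr => b _; rewrite mxE scalerBl.
rewrite !nab_nab [X in _ - (_ + X) - _]exchange_big /=.
set A := \sum_b derU X _ *: _; set B := \sum_b derU Y _ *: _.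
set C1 := \sum_a _; set C2 := \sum_a _.
transitivity (C1 - C2); first by apply/matrixP => i j; rewrite !mxlin; ring.
rewrite -sumrB; apply: eq_bigr => a _; rewrite -sumrB; apply: eq_bigr => b _.
by rewrite (mulrC (Y _ _)) -scalerBr nabE_comm.
Qed.

Lemma Rm_ev4 (g : 'M[S]_n) X Y Z W :
  (curvf X Y Z *m g *m W^T) ord0 ord0 = ev4 (Rd D Gm g) X Y Z W.
Proof.
rewrite curvfE !mulmx_suml summxE; apply: eq_bigr => a _.
rewrite !mulmx_suml summxE mulr_sumr; apply: eq_bigr => b _.
rewrite -!scalemxAl mxE -mulrA; congr (_ * (_ * _)).
rewrite -!mulmxA mxE; apply: eq_bigr => c _; congr (_ * _).
rewrite mulmxA mxE; apply: eq_bigr => d _; rewrite [W^T _ _]mxE mulrC.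
by rewrite /Rd.
Qed.

End TensorFields.

(** * Evaluation of tensor products and the contracted identity on vector fields *)

Section TracedIdentity.
Context {S : comPzRingType} {n : nat}.
Implicit Types (X Y Z W : 'rV[S]_n).

Lemma ct_delta i (F : 'I_n -> S) : ct (delta_mx ord0 i) F = F i.
Proof.
rewrite /ct (bigD1 i)//= mxE !eqxx mul1r big1 ?addr0// => k /negbTE ki.
by rewrite mxE eqxx ki mul0r.
Qed.

Definition ev2 (T : 'I_n -> 'I_n -> S) X Y := ct X (fun a => ct Y (T a)).

Lemma ctZr X c (F : 'I_n -> S) : ct X (fun a => F a * c) = ct X F * c.
Proof. by rewrite /ct mulr_suml; apply: eq_bigr => a _; rewrite mulrA. Qed.

Lemma ev4D T T' X Y Z W : ev4 (fun a b c d => T a b c d + T' a b c d) X Y Z W =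
  ev4 T X Y Z W + ev4 T' X Y Z W.
Proof. by rewrite /ev4 -ctD; do 3!(apply: ct_ext => ?; rewrite -ctD). Qed.

Lemma ev4Z k T X Y Z W : ev4 (fun a b c d => k * T a b c d) X Y Z W =
  k * ev4 T X Y Z W.
Proof. by rewrite /ev4 -ctZ; do 3!(apply: ct_ext => ?; rewrite -ctZ). Qed.

Lemma ev4_ext T T' X Y Z W : (forall a b c d, T a b c d = T' a b c d) ->
  ev4 T X Y Z W = ev4 T' X Y Z W.
Proof. by move=> E; do 4!apply: ct_ext => ?. Qed.

Lemma ev4_adbc T T' X Y Z W :
  ev4 (fun a b c d => T a d * T' b c) X Y Z W = ev2 T X W * ev2 T' Y Z.
Proof.
rewrite /ev2 -ctZr; apply: ct_ext => a; rewrite -ctZ; apply: ct_ext => b.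
rewrite -ctZ; apply: ct_ext => c; exact: ctZr.
Qed.

Lemma ev4_acbd T T' X Y Z W :
  ev4 (fun a b c d => T a c * T' b d) X Y Z W = ev2 T X Z * ev2 T' Y W.
Proof.
rewrite /ev2 -ctZr; apply: ct_ext => a; rewrite -ctZ; apply: ct_ext => b.
rewrite -ctZr; apply: ct_ext => c; exact: ctZ.
Qed.

Lemma ev4_odt h s r X Y Z W : ev4 (odt h s r) X Y Z W =
  h * (ev2 r X W * ev2 s Y Z + ev2 r Y Z * ev2 s X W
       - ev2 r X Z * ev2 s Y W - ev2 r Y W * ev2 s X Z).
Proof.
transitivity (ev4 (fun a b c d => h * (r a d * s b c) + h * (s a d * r b c) +
   (- h) * (r a c * s b d) + (- h) * (s a c * r b d)) X Y Z W).
  by apply: ev4_ext => a b c d; rewrite /odt; ring.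
by rewrite !ev4D !ev4Z !ev4_adbc !ev4_acbd; ring.
Qed.

Lemma ct_tr2 (gi : 'M[S]_n) X (T : 'I_n -> 'I_n -> 'I_n -> S) :
  ct X (fun a => tr2 gi (T a)) = tr2 gi (fun i j => ct X (fun a => T a i j)).
Proof. by rewrite tr2_sum; apply: eq_bigr => a _; rewrite tr2Z. Qed.

Lemma tr2_ev4 (gi : 'M[S]_n) T X W :
  tr2 gi (fun i j => ev4 T X (delta_mx ord0 i) (delta_mx ord0 j) W) =
  ev2 (fun a d => tr2 gi (fun b c => T a b c d)) X W.
Proof.
rewrite /ev2; under [RHS]ct_ext do rewrite ct_tr2; rewrite ct_tr2.
by apply: tr2_ext => i j; apply: ct_ext => a; rewrite !ct_delta.
Qed.

Lemma tr2_ev4_last (gi : 'M[S]_n) (T : 'I_n -> 'I_n -> 'I_n -> 'I_n -> 'I_n -> S)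
    X Y Z :
  tr2 gi (fun i j => ev4 (T i) X Y Z (delta_mx ord0 j)) =
  ct X (fun a => ct Y (fun b => ct Z (fun c =>
    tr2 gi (fun i j => T i a b c j)))).
Proof.
under [RHS]ct_ext do under ct_ext do rewrite ct_tr2.
under [RHS]ct_ext do rewrite ct_tr2; rewrite ct_tr2.
apply: tr2_ext => i j; do 3!apply: ct_ext => ?; exact: ct_delta.
Qed.

Variable D : 'I_n -> S -> S.
Hypothesis DD : forall i a b, D i (a + b) = D i a + D i b.
Hypothesis DM : forall i a b, D i (a * b) = D i a * b + a * D i b.
Hypothesis DC : forall i j a, D i (D j a) = D j (D i a).
Variable Gm : 'I_n -> 'M[S]_n.
Hypothesis GmS : forall a b k, Gm a b k = Gm b a k.
Variables g gi : 'M[S]_n.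
Hypothesis gS : g^T = g.
Hypothesis ggi : g *m gi = 1%:M.
Hypothesis Dg : forall e, dmx D e g = Gm e *m g + g *m (Gm e)^T.
Variables w m mi m1i h lam : S.
Hypothesis mmi : m * mi = 1.
Hypothesis m1m1i : (m - 1) * m1i = 1.
Hypothesis hh : 2 * h = 1.
Hypothesis Dmi : forall e, D e mi = 0.
Hypothesis Dm1i : forall e, D e m1i = 0.
Hypothesis Dlam : forall e, D e lam = 0.
Hypothesis einstein :
  forall b c, hess D Gm w b c = w * mi * (Rc D Gm g gi b c - lam * g b c).

Local Notation Q := (Qd D Gm g gi mi m1i h lam).

(** The summand is what the product rule leaves of the covariant derivative of w^(m+1) Q once w^m is
    factored out. *)
Lemma div_grad_Q_fields X Y Z :
  tr2 gi (fun i j => w * ev4 (cov4 D Gm i Q) X Y Z (delta_mx ord0 j) +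
    (m + 1) * (D i w * ev4 Q X Y Z (delta_mx ord0 j))) = 0.
Proof.
transitivity (tr2 gi (fun i j => ev4 (fun a b c d => w * cov4 D Gm i Q a b c d +
    (m + 1) * (D i w * Q a b c d)) X Y Z (delta_mx ord0 j))).
  apply: tr2_ext => i j.
  rewrite (ev4D (fun a b c d => w * cov4 D Gm i Q a b c d)
      (fun a b c d => (m + 1) * (D i w * Q a b c d))) (ev4Z w (cov4 D Gm i Q)).
  by rewrite (ev4Z (m + 1) (fun a b c d => D i w * Q a b c d)) (ev4Z (D i w) Q).
rewrite (tr2_ev4_last gi (fun i a b c d => w * cov4 D Gm i Q a b c d +
    (m + 1) * (D i w * Q a b c d))).
rewrite /ct big1// => a _; rewrite big1 ?mulr0// => b _; rewrite big1 ?mulr0// => c _.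
rewrite tr2D !tr2Z (div_grad_Q DD DM DC GmS gS ggi Dg mmi m1m1i hh Dmi Dm1i Dlam einstein).
by rewrite mulr0.
Qed.

End TracedIdentity.

(** * Functions of class C^k: algebra, linearity of the derivative, mixed derivatives *)

Section DirectionalCalculus.
Context {R : realType} {V : normedModType R}.
Implicit Types (f g : V -> R) (U : set V) (x u v : V) (k : nat).

Lemma Ck_sub (W : normedModType R) k (A U : set V) (f : V -> W) :
  A `<=` U -> Ck k U f -> Ck k A f.
Proof.
elim: k f => [|k IH] f AU [fc fd]; split=> //; first by move=> x /AU; exact: fc.
  by move=> x /AU; exact: fc.
by move=> v; have [d c] := fd v; split; [move=> x /AU; exact: d | exact: IH].
Qed.

Lemma CkS (W : normedModType R) k U (f : V -> W) : Ck k.+1 U f -> Ck k U f.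
Proof.
elim: k f => [|k IH] f [fc fd]; first by split.
by split=> // v; have [d c] := fd v; split=> //; exact: IH.
Qed.

Lemma near_open_eq (W : normedModType R) U (f g : V -> W) x :
  open U -> (forall y, U y -> f y = g y) -> U x -> {near x, f =1 g}.
Proof.
move=> Uo fg Ux; near=> y; apply: fg; near: y; exact: open_nbhs_nbhs.
Unshelve. all: by end_near. Qed.

Lemma open_eq_continuous (W : normedModType R) U (f g : V -> W) x :
  open U -> (forall y, U y -> f y = g y) -> U x ->
  {for x, continuous f} -> {for x, continuous g}.
Proof.
move=> Uo fg Ux fc; have E := near_open_eq Uo fg Ux.
have : g @ x --> f x by apply: cvg_trans fc; exact: near_eq_cvg.
by rewrite (fg x Ux).
Qed.

Lemma Ck_ext (W : normedModType R) k U (f g : V -> W) :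
  open U -> (forall y, U y -> f y = g y) -> Ck k U f -> Ck k U g.
Proof.
move=> Uo; elim: k f g => [|k IH] f g fg [fc fd].
  by split=> // x Ux; exact: (open_eq_continuous Uo fg Ux (fc x Ux)).
split=> [x Ux|v]; first exact: (open_eq_continuous Uo fg Ux (fc x Ux)).
have [d c] := fd v; split=> [x Ux|].
  exact: near_eq_derivable (near_open_eq Uo fg Ux) (d x Ux).
apply: IH c => x Ux; exact: near_eq_derive (near_open_eq Uo fg Ux).
Qed.

Lemma Ck_cst (W : normedModType R) k U (a : W) : open U -> Ck k U (fun=> a).
Proof.
move=> Uo; elim: k a => [|k IH] a; first by split=> // x _; exact: cvg_cst.
split=> [x _|v]; first exact: cvg_cst.
split=> [x _|]; first exact: derivable_cst.
by apply: Ck_ext (IH 0) => // x _; rewrite (derive_cst a).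
Qed.

Lemma CkD k U f g : open U -> Ck k U f -> Ck k U g -> Ck k U (fun x => f x + g x).
Proof.
move=> Uo; elim: k f g => [|k IH] f g [fc fd] [gc gd].
  by split=> // x Ux; apply: cvgD; [exact: fc | exact: gc].
split=> [x Ux|v]; first by apply: cvgD; [exact: fc | exact: gc].
have [d c] := fd v; have [d' c'] := gd v; split=> [x Ux|].
  by apply: derivableD; [exact: d | exact: d'].
apply: Ck_ext (IH _ _ c c') => // x Ux.
by rewrite -deriveD//; [exact: d | exact: d'].
Qed.

Lemma CkM k U f g : open U -> Ck k U f -> Ck k U g -> Ck k U (fun x => f x * g x).
Proof.
move=> Uo; elim: k f g => [|k IH] f g Cf Cg; have [fc fd] := Cf; have [gc gd] := Cg.
  by split=> // x Ux; apply: cvgM; [exact: fc | exact: gc].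
split=> [x Ux|v]; first by apply: cvgM; [exact: fc | exact: gc].
have [d c] := fd v; have [d' c'] := gd v; split=> [x Ux|].
  by apply: derivableM; [exact: d | exact: d'].
apply: Ck_ext (CkD Uo (IH _ _ (CkS Cf) c') (IH _ _ (CkS Cg) c)) => // x Ux.
by apply/esym; exact: (deriveM (d x Ux) (d' x Ux)).
Qed.

Lemma CkN k U f : open U -> Ck k U f -> Ck k U (fun x => - f x).
Proof.
move=> Uo; have C1 : Ck k U (fun=> -1 : R) by exact: Ck_cst.
by move=> /(CkM Uo C1); apply: Ck_ext => // x _; rewrite mulN1r.
Qed.

Lemma CkV k U f : open U -> (forall x, U x -> f x != 0) ->
  Ck k U f -> Ck k U (fun x => (f x)^-1).
Proof.
move=> Uo f0; elim: k => [|k IH] Cf; have [fc fd] := Cf.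
  by split=> // x Ux; apply: cvgV; [exact: f0 | exact: fc].
split=> [x Ux|v]; first by apply: cvgV; [exact: f0 | exact: fc].
have [d c] := fd v; split=> [x Ux|].
  by apply: derivableV; [exact: f0 | exact: d].
have Ci := IH (CkS Cf).
apply: Ck_ext (CkM Uo (CkN Uo (CkM Uo Ci Ci)) c) => // x Ux.
by rewrite deriveV ?f0//; [rewrite expr2 invfM | exact: d].
Qed.

Lemma Ck_coord p q k U (F : V -> 'M[R]_(p, q)) i j :
  open U -> Ck k U F -> Ck k U (fun x => F x i j).
Proof.
move=> Uo; have C G x : {for x, continuous G} ->
    {for x, continuous (fun y : V => (G y : 'M[R]_(p, q)) i j)}.
  by move=> Gc; apply: (@continuous_comp _ _ _ G (fun M => M i j)) => //;
    exact: coord_continuous.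
elim: k F => [|k IH] F [Fc Fd].
  by split=> // x Ux; apply: C; exact: Fc.
split=> [x Ux|v]; first by apply: C; exact: Fc.
have [d c] := Fd v; split=> [x Ux|].
  by have /derivable_mxP := d _ Ux; exact.
by apply: Ck_ext (IH _ c) => // x Ux; rewrite derive_mx ?mxE//; exact: d.
Qed.

Lemma is_derive_line f x u (s : R) : derivable f (s *: u + x) u ->
  is_derive s 1 (fun t : R => f (t *: u + x)) ('D_u f (s *: u + x)).
Proof.
move=> df.
have E : (fun h : R => h^-1 *: (((fun t : R => f (t *: u + x)) \o shift s) (h *: 1)
      - f (s *: u + x))) =
    (fun h => h^-1 *: ((f \o shift (s *: u + x)) (h *: u) - f (s *: u + x))).
  by apply/funext => h /=; rewrite scalerDl addrA [h *: 1]mulr1.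
by apply: DeriveDef; rewrite /derivable /derive /= E.
Qed.

Lemma is_derive_translate f c y u : derivable f (c + y) u ->
  is_derive y u (fun z => f (c + z)) ('D_u f (c + y)).
Proof.
move=> df.
have E : (fun h : R => h^-1 *: (((fun z => f (c + z)) \o shift y) (h *: u)
      - f (c + y))) =
    (fun h => h^-1 *: ((f \o shift (c + y)) (h *: u) - f (c + y))).
  by apply/funext => h /=; rewrite addrCA.
by apply: DeriveDef; rewrite /derivable /derive /= E.
Qed.

(** The intermediate point is bounded by absolute values so that [t] may have either sign. *)
Lemma MVT_line f x u (t : R) :
  (forall s : R, `|s| <= `|t| -> derivable f (s *: u + x) u) ->
  exists2 s : R, `|s| <= `|t| & f (t *: u + x) - f x = t * 'D_u f (s *: u + x).
Proof.
move=> df; pose g (s : R) := f (s *: u + x).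
have dg (s : R) : `|s| <= `|t| -> is_derive s 1 g ('D_u f (s *: u + x)).
  by move=> st; apply: is_derive_line; exact: df.
have g0 : g 0 = f x by rewrite /g scale0r add0r.
have gc (a b : R) : (forall s : R, a <= s <= b -> `|s| <= `|t|) ->
    {within `[a, b], continuous g}.
  move=> ab; apply: derivable_within_continuous => s.
  by rewrite in_itv /= => /ab /dg [].
rewrite -g0 -/(g t).
have [t0|t0] := leP 0 t.
  have st (s : R) : 0 <= s <= t -> `|s| <= `|t|.
    by case/andP => s0 st; rewrite !ger0_norm.
  have [c ct ->] : exists2 c : R, c \in `[0, t] & g t - g 0 = 'D_u f (c *: u + x) * (t - 0).
    apply: MVT_segment => //; last exact: gc.
    by move=> s; rewrite in_itv /= => /andP[/ltW a /ltW b]; apply/dg/st/andP.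
  by exists c; [apply: st; move: ct; rewrite in_itv | rewrite subr0 mulrC].
have st (s : R) : t <= s <= 0 -> `|s| <= `|t|.
  by case/andP => a b; rewrite !ler0_norm// ?lerN2// ltW.
have [c ct E] : exists2 c : R, c \in `[t, 0] & g 0 - g t = 'D_u f (c *: u + x) * (0 - t).
  apply: MVT_segment; [exact: ltW | | exact: gc].
  by move=> s; rewrite in_itv /= => /andP[/ltW a /ltW b]; apply/dg/st/andP.
exists c; first by apply: st; move: ct; rewrite in_itv.
by rewrite -[LHS]opprB E; ring.
Qed.

(* Strict differentiability along v: the base point p may vary too. *)
Lemma strict_derive f U x v (e : R) : open U -> U x -> Ck 1 U f -> 0 < e ->
  exists2 d : R, 0 < d & forall p (t : R), `|p - x| < d -> `|t *: v| < d ->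
    `|f (t *: v + p) - f p - t * 'D_v f x| <= e * `|t|.
Proof.
move=> Uo Ux [_ /(_ v)[df [cf _]]] e0.
have : \forall y \near x, U y /\ `|'D_v f x - 'D_v f y| <= e.
  near=> y; split; first by near: y; exact: open_nbhs_nbhs.
  near: y; have /cvgrPdist_le := cf x Ux; exact.
move=> /nbhs_ballP[d /= d0 Bd]; exists (d / 2); first by rewrite divr_gt0.
move=> p t px tv.
have B (s : R) : `|s| <= `|t| -> ball x d (s *: v + p).
  move=> st; rewrite -ball_normE /= distrC -addrA (splitr d).
  rewrite (le_lt_trans (ler_normD _ _))// ltrD//.
  by apply: le_lt_trans tv; rewrite !normrZ ler_wpM2r.
have [s st ->] : exists2 s : R, `|s| <= `|t| &
    f (t *: v + p) - f p = t * 'D_v f (s *: v + p).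
  by apply: MVT_line => s /B /Bd[/df].
rewrite -mulrBr normrM mulrC ler_wpM2r// distrC.
by have [] := Bd _ (B _ st).
Unshelve. all: by end_near. Qed.

(** The increment along [a *: u + v] splits into one along [v] at [x] and one along [u] at the
    moving point [h *: v + x]; the latter is controlled by [strict_derive]. *)
Lemma derive_linear f U x u v (a : R) : open U -> U x -> Ck 1 U f ->
  'D_(a *: u + v) f x = a * 'D_u f x + 'D_v f x.
Proof.
move=> Uo Ux Cf; have [_ fd] := Cf; have [/(_ _ Ux) dv _] := fd v.
apply: cvg_lim => //.
have E : (fun h : R => h^-1 *: ((f \o shift x) (h *: (a *: u + v)) - f x)) =
    (fun h => h^-1 * (f ((h * a) *: u + (h *: v + x)) - f (h *: v + x))
              + h^-1 *: ((f \o shift x) (h *: v) - f x)).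
  apply/funext => h /=.
  have -> : h *: (a *: u + v) + x = (h * a) *: u + (h *: v + x).
    by rewrite scalerDr scalerA addrA.
  by rewrite -[RHS]mulrDr subrKA.
rewrite E; apply: cvgD => //.
apply/cvgrPdist_le => e e0.
(* The summand 1 allows [a = 0] in the quotient [e / (|a| + 1)]. *)
have a1 : 0 < `|a| + 1 by rewrite ltr_wpDl.
have [d d0 Hd] := strict_derive u Uo Ux Cf (divr_gt0 e0 a1).
have cv (y : V) : \forall h \near (0 : R)^', `|h *: y| < d.
  have : (fun h : R => h *: y) @ (0 : R)^' --> (0 : R) *: y.
    apply: cvgZr_tmp; exact: cvg_within.
  rewrite scale0r => /cvgr0Pnorm_lt; exact.
near=> h.
have h0 : h != 0 by near: h; exact: nbhs_dnbhs_neq.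
have -> : a * 'D_u f x - h^-1 * (f ((h * a) *: u + (h *: v + x)) - f (h *: v + x)) =
    - (h^-1 * (f ((h * a) *: u + (h *: v + x)) - f (h *: v + x)
               - (h * a) * 'D_u f x)).
  by field.
rewrite normrN normrM normfV ler_pdivrMl ?normr_gt0//.
apply: le_trans (Hd _ _ _ _) _.
- by rewrite addrK; near: h; exact: cv.
- by rewrite -scalerA; near: h; exact: cv.
- rewrite normrM mulrCA ler_wpM2l// -mulrA ler_piMr ?(ltW e0)//.
  by rewrite mulrC ler_pdivrMr// mul1r lerDl.
Unshelve. all: by end_near. Qed.

(** Two applications of the mean value theorem, along [u] and then along [v], turn the second
    difference into [t ^+ 2] times a mixed derivative at a nearby point, and that derivative is
    continuous. *)
Lemma schwarz_half f U x u v (e : R) : open U -> U x -> Ck 2 U f -> 0 < e ->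
  exists2 d : R, 0 < d & forall t : R, 0 < t < d ->
    `|t ^- 2 * (f (t *: u + (t *: v + x)) - f (t *: u + x) - f (t *: v + x) + f x)
      - 'D_v ('D_u f) x| <= e.
Proof.
move=> Uo Ux [_ /(_ u)[df [_ /(_ v)[ddf [cf _]]]]] e0.
have : \forall y \near x, U y /\ `|'D_v ('D_u f) x - 'D_v ('D_u f) y| <= e.
  near=> y; split; first by near: y; exact: open_nbhs_nbhs.
  near: y; have /cvgrPdist_le := cf x Ux; exact.
move=> /nbhs_ballP[r /= r0 Br].
have n1 : 0 < `|u| + `|v| + 1 by rewrite ltr_wpDl// addr_ge0.
exists (r / (`|u| + `|v| + 1)); first exact: divr_gt0.
move=> t /andP[t0]; rewrite ltr_pdivlMr// => tr.
have B (s s' : R) : `|s| <= t -> `|s'| <= t -> ball x r (s' *: v + (s *: u + x)).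
  move=> st s't; rewrite -ball_normE /= distrC addrA addrK.
  apply: le_lt_trans (ler_normD _ _) _; rewrite !normrZ.
  apply: le_lt_trans tr; rewrite !mulrDr mulr1 addrC.
  by rewrite ler_wpDr ?(ltW t0)// lerD ?ler_wpM2r.
(* The second difference of [f] is the first difference of [H] along [u]. *)
pose H (y : V) := f (t *: v + y) - f y.
have DH y : U (t *: v + y) -> U y ->
    derivable H y u /\ 'D_u H y = 'D_u f (t *: v + y) - 'D_u f y.
  move=> /df d1 /df d2.
  have d3 := is_derive_translate d1.
  have d4 : is_derive y u H ('D_u f (t *: v + y) - 'D_u f y).
    exact: (@is_deriveB _ _ _ _ f _ _ _ _ d3 (derivableP d2)).
  by split; [exact: (@ex_derive _ _ _ _ _ _ _ d4) | exact: (@derive_val _ _ _ _ _ _ _ d4)].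
have tE : `|t| = t by rewrite gtr0_norm.
have UB s s' : `|s| <= t -> `|s'| <= t -> U (s' *: v + (s *: u + x)).
  by move=> st s't; have [] := Br _ (B _ _ st s't).
have z0 : `|0 : R| <= t by rewrite normr0 ltW.
have UB0 s : `|s| <= t -> U (s *: u + x).
  by move=> st; have := UB _ 0 st z0; rewrite scale0r add0r.
have [s st E] : exists2 s : R, `|s| <= `|t| &
    H (t *: u + x) - H x = t * 'D_u H (s *: u + x).
  apply: MVT_line => s; rewrite tE => st.
  by have [] := DH _ (UB _ t st _) (UB0 _ st); rewrite ?tE.
rewrite tE in st.
have [_ E2] : derivable H (s *: u + x) u /\ 'D_u H (s *: u + x) =
    'D_u f (t *: v + (s *: u + x)) - 'D_u f (s *: u + x).
  by apply: DH; [apply: UB; rewrite ?tE | exact: UB0].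
have [s' s't E3] : exists2 s' : R, `|s'| <= `|t| &
    'D_u f (t *: v + (s *: u + x)) - 'D_u f (s *: u + x) =
    t * 'D_v ('D_u f) (s' *: v + (s *: u + x)).
  apply: (@MVT_line (fun y => 'D_u f y) (s *: u + x) v t) => s'.
  by rewrite tE => s't; apply: ddf; exact: UB.
rewrite tE in s't.
have -> : f (t *: u + (t *: v + x)) - f (t *: u + x) - f (t *: v + x) + f x =
    t ^+ 2 * 'D_v ('D_u f) (s' *: v + (s *: u + x)).
  rewrite expr2 -mulrA -E3 -E2 -E /H (addrCA (t *: v)); ring.
rewrite mulKf ?expf_neq0 ?gt_eqF// distrC.
by have [] := Br _ (B _ _ st s't).
Unshelve. all: by end_near. Qed.

(** The second difference is symmetric in [u] and [v], so for one small [t] the same number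
    approximates both mixed derivatives. *)
Lemma schwarz f U x u v : open U -> U x -> Ck 2 U f ->
  'D_v ('D_u f) x = 'D_u ('D_v f) x.
Proof.
move=> Uo Ux Cf; apply/eqP; rewrite -subr_eq0 -normr_le0; apply/ler_addgt0Pr => e e0.
have e2 : 0 < e / 2 by rewrite divr_gt0.
have [d d0 H] := schwarz_half u v Uo Ux Cf e2.
have [d' d'0 H'] := schwarz_half v u Uo Ux Cf e2.
pose t := Num.min d d' / 2.
have m0 : 0 < Num.min d d' by rewrite lt_min d0.
have td : 0 < t < d.
  by rewrite divr_gt0//= ltr_pdivrMr// (@le_lt_trans _ _ d) ?ge_min ?lexx// mulr2n mulrDr mulr1 ltrDl.
have td' : 0 < t < d'.
  by rewrite divr_gt0//= ltr_pdivrMr// (@le_lt_trans _ _ d') ?ge_min ?lexx ?orbT// mulr2n mulrDr mulr1 ltrDl.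
have {H} := H t td; have := H' t td'.
set X := 'D_v _ x; set Y := 'D_u _ x; set B' := t ^- 2 * _; set B := t ^- 2 * _ => H1 H2.
have BE : B' = B by rewrite /B /B' (addrCA (t *: v)); congr (_ * _); ring.
rewrite BE in H1; clearbody X Y B; rewrite add0r (splitr e) -(subrKA B X (- Y)) (le_trans (ler_normD _ _))// lerD//.
by rewrite distrC.
Qed.

End DirectionalCalculus.

(** * Algebra of functions smooth up to the boundary *)

Section SmoothOn.
Context {R : realType} {V : normedModType R}.
Implicit Types (A : set V) (f g : V -> R).

Lemma smooth_on_cst (W : normedModType R) A (a : W) : smooth_on A (fun=> a).
Proof.
move=> x Ax; exists setT, (fun=> a); split=> //; first exact: openT.
by move=> k; apply: Ck_cst; exact: openT.
Qed.

Lemma smooth_on_ext (W : normedModType R) A (f g : V -> W) :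
  (forall y, A y -> f y = g y) -> smooth_on A f -> smooth_on A g.
Proof.
move=> fg sf x Ax; have [U [F [Uo Ux FC Ff]]] := sf x Ax.
by exists U, F; split=> // y Uy Ay; rewrite Ff// fg.
Qed.

Lemma smooth_onD A f g :
  smooth_on A f -> smooth_on A g -> smooth_on A (fun x => f x + g x).
Proof.
move=> sf sg x Ax; have [U [F [Uo Ux FC Ff]]] := sf x Ax.
have [U' [G [Uo' Ux' GC Gg]]] := sg x Ax.
have UUo : open (U `&` U') by exact: openI.
exists (U `&` U'), (fun x => F x + G x); split=> // [k|y [Uy Uy'] Ay].
  by apply: CkD => //; apply: Ck_sub; [exact: subIsetl | exact: FC
    | exact: subIsetr | exact: GC].
by rewrite Ff// Gg.
Qed.

Lemma smooth_onM A f g :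
  smooth_on A f -> smooth_on A g -> smooth_on A (fun x => f x * g x).
Proof.
move=> sf sg x Ax; have [U [F [Uo Ux FC Ff]]] := sf x Ax.
have [U' [G [Uo' Ux' GC Gg]]] := sg x Ax.
have UUo : open (U `&` U') by exact: openI.
exists (U `&` U'), (fun x => F x * G x); split=> // [k|y [Uy Uy'] Ay].
  by apply: CkM => //; apply: Ck_sub; [exact: subIsetl | exact: FC
    | exact: subIsetr | exact: GC].
by rewrite Ff// Gg.
Qed.

Lemma smooth_onN A f : smooth_on A f -> smooth_on A (fun x => - f x).
Proof.
move=> sf; have := smooth_onM (@smooth_on_cst R A (-1 : R)) sf.
by apply: smooth_on_ext => y _; rewrite mulN1r.
Qed.

Lemma smooth_onV A f : (forall x, A x -> f x != 0) ->
  smooth_on A f -> smooth_on A (fun x => (f x)^-1).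
Proof.
move=> f0 sf x Ax; have [U [F [Uo Ux FC Ff]]] := sf x Ax.
have Fx0 : F x != 0 by rewrite Ff// f0.
have Fc : {for x, continuous F} by have [c _] := FC 0%N; exact: c.
(* Only [f] on [A] is known to be nonzero; the extension [F] may vanish elsewhere, so its domain is
   shrunk. *)
have : \forall y \near x, U y /\ F y != 0.
  near=> y; split; first by near: y; exact: open_nbhs_nbhs.
  near: y; exact: cvgr_neq0 Fc Fx0.
rewrite -nbhs_nearE nbhsE => -[U' [U'o U'x] UU'].
exists U', (fun x => (F x)^-1); split=> // [k|y /UU'[Uy _] Ay]; last by rewrite Ff.
apply: CkV => // [y /UU'[]//|].
by apply: Ck_sub (FC k) => y /UU'[].
Unshelve. all: by end_near. Qed.

Lemma smooth_on_coord p q A (F : V -> 'M[R]_(p, q)) i j :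
  smooth_on A F -> smooth_on A (fun x => F x i j).
Proof.
move=> sf x Ax; have [U [G [Uo Ux GC Gf]]] := sf x Ax.
exists U, (fun x => G x i j); split=> // [k|y Uy Ay]; first exact: Ck_coord.
by rewrite Gf.
Qed.

End SmoothOn.

(** * Derivatives inside the half-space *)

Section DerivativeWithin.
Context {R : realType} {n : nat}.
Local Notation V := 'rV[R]_n.
Implicit Types (x v : V).

Definition dquot (W : normedModType R) (f : V -> W) x v (h : R) : W :=
  h^-1 *: (f (h *: v + x) - f x).

(* The filter along which dwithin half_space takes its limit. *)
Definition hdir x v := within [set h : R | half_space (h *: v + x)] (0 : R)^'.

(** From a point of the half-space, at least one of the directions [v] and [- v] stays inside; the
    first coordinate of [v] decides the sign of [h]. Properness makes limits along [hdir] unique. *)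
Lemma hdir_proper x v : half_space x -> ProperFilter (hdir x v).
Proof.
move=> hx; apply: Build_ProperFilter => -[e /= e0 He].
pose h : R := if [forall i : 'I_n, (i == 0%N :> nat) ==> (0 <= v ord0 i)]
  then e / 2 else - (e / 2).
have e2 : 0 < e / 2 by rewrite divr_gt0.
have h0 : h != 0 by rewrite /h; case: ifP; rewrite ?oppr_eq0 gt_eqF.
have hE : `|h| = e / 2 by rewrite /h; case: ifP; rewrite ?normrN gtr0_norm.
apply: (He h) => //.
  by rewrite /= sub0r normrN hE ltr_pdivrMr// mulr2n mulrDr mulr1 ltrDl.
move=> i i0; rewrite !mxE; apply: addr_ge0; last exact: hx.
rewrite /h; case: ifPn => [/forallP/(_ i)|].
  by rewrite i0 eqxx /= => vi; rewrite mulr_ge0// ltW.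
rewrite negb_forall => /existsP[j]; rewrite negb_imply => /andP[/eqP j0].
rewrite -ltNge (_ : j = i); last by apply: val_inj; rewrite /= j0 i0.
by move=> vi; rewrite mulr_le0// ?ltW// oppr_lt0.
Qed.

Lemma near_line x v (U : set V) : open U -> U x ->
  \forall h \near (0 : R)^', U (h *: v + x).
Proof.
move=> Uo Ux.
have : (fun h : R => h *: v + x) @ (0 : R)^' --> (0 : R) *: v + x.
  by apply: cvgD; [apply: cvgZr_tmp; exact: cvg_within | exact: cvg_cst].
by rewrite scale0r add0r; apply; exact: open_nbhs_nbhs.
Qed.

Lemma near_hdir x v (U : set V) : open U -> U x ->
  \forall h \near hdir x v, U (h *: v + x) /\ half_space (h *: v + x).
Proof.
move=> Uo Ux; rewrite near_withinE.
by apply: filterS (near_line v Uo Ux) => h Uh hh; split.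
Qed.

Lemma dwithin_lim (W : normedModType R) (f : V -> W) x v l : half_space x ->
  dquot f x v @ hdir x v --> l -> dwithin half_space f x v = l.
Proof.
by move=> hx fl; have P := hdir_proper v hx; apply: cvg_lim.
Qed.

Lemma dquot_mx p q (F : V -> 'M[R]_(p, q)) x v (l : 'M[R]_(p, q)) :
  half_space x ->
  (forall i j, dquot (fun y => F y i j) x v @ hdir x v --> l i j) ->
  dquot F x v @ hdir x v --> l.
Proof.
move=> hx Fl; have P := hdir_proper v hx; apply/cvgrPdist_le => e e0; near=> h.
rewrite /Num.Def.normr/= mx_normrE (bigmax_le _ (ltW e0))//= => i _.
rewrite !mxE/=; move: i; near: h; apply: filter_forall => -[i j] /=.
by have /cvgrPdist_le := Fl i j; exact.
Unshelve. all: by end_near. Qed.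

Context {A O : set V}.
Hypothesis Oo : open O.
Hypothesis AE : A = O `&` half_space.

Lemma chart_half_space x : A x -> half_space x.
Proof. by rewrite AE => -[]. Qed.

Lemma dquot_cvg_ext (f F : V -> R) U x v : open U -> U x -> A x ->
  (forall y, U y -> A y -> F y = f y) -> derivable F x v ->
  dquot f x v @ hdir x v --> 'D_v F x.
Proof.
move=> Uo Ux Ax Ff dF.
have : dquot F x v @ hdir x v --> 'D_v F x.
  by apply: cvg_trans dF; apply: cvg_app; exact: cvg_within.
move=> FL; apply: cvg_trans FL; apply: near_eq_cvg.
have Ox : (O `&` U) x by split=> //; move: Ax; rewrite AE => -[].
have := near_hdir v (openI Oo Uo) Ox; apply: filterS => h [[Oh Uh] hh].
by rewrite /dquot !Ff// AE.
Qed.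

(** Along [hdir] the points stay in [A], where [F] and [f] agree. Through this lemma the calculus on
    open sets carries over to boundary points. *)
Lemma dwithin_ext (f F : V -> R) U x v : open U -> U x -> A x ->
  (forall y, U y -> A y -> F y = f y) -> derivable F x v ->
  dwithin half_space f x v = 'D_v F x.
Proof.
move=> Uo Ux Ax Ff dF; apply: dwithin_lim; first exact: chart_half_space.
exact: (dquot_cvg_ext Uo Ux Ax Ff dF).
Qed.

Lemma smooth_on_dwithin (f : V -> R) v : smooth_on A f ->
  smooth_on A (fun y => dwithin half_space f y v).
Proof.
move=> sf x Ax; have [U [F [Uo Ux FC Ff]]] := sf x Ax.
exists U, (fun y => 'D_v F y); split=> // [k|y Uy Ay].
  by have [_ /(_ v)[]] := FC k.+1.
apply/esym; apply: dwithin_ext Ff _ => //.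
by have [_ /(_ v)[d _]] := FC 1%N; exact: d.
Qed.

Lemma dquot_cvg (f : V -> R) x v : smooth_on A f -> A x ->
  dquot f x v @ hdir x v --> dwithin half_space f x v.
Proof.
move=> sf Ax; have [U [F [Uo Ux FC Ff]]] := sf x Ax.
have dF : derivable F x v by have [_ /(_ v)[d _]] := FC 1%N; exact: d.
by rewrite (dwithin_ext Uo Ux Ax Ff dF); exact: (dquot_cvg_ext Uo Ux Ax Ff dF).
Qed.

Lemma dwithin_cst (a : R) x v : half_space x -> dwithin half_space (fun=> a) x v = 0.
Proof.
move=> hx; apply: dwithin_lim => //; rewrite (_ : dquot _ _ _ = fun=> 0).
  exact: cvg_cst.
by apply/funext => h; rewrite /dquot subrr scaler0.
Qed.

Lemma dwithinD (f g : V -> R) x v : smooth_on A f -> smooth_on A g -> A x ->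
  dwithin half_space (fun y => f y + g y) x v =
  dwithin half_space f x v + dwithin half_space g x v.
Proof.
move=> sf sg Ax; have hx := chart_half_space Ax; have P := hdir_proper v hx.
apply: dwithin_lim => //.
have -> : dquot (fun y => f y + g y) x v = dquot f x v \+ dquot g x v.
  by apply/funext => h; rewrite /dquot /= -scalerDr opprD addrACA.
by apply: cvgD; exact: dquot_cvg.
Qed.

Lemma dwithinM (f g : V -> R) x v : smooth_on A f -> smooth_on A g -> A x ->
  dwithin half_space (fun y => f y * g y) x v =
  dwithin half_space f x v * g x + f x * dwithin half_space g x v.
Proof.
move=> sf sg Ax; have [U [F [Uo Ux FC Ff]]] := sf x Ax.
have [U' [G [Uo' Ux' GC Gg]]] := sg x Ax.
have dF : derivable F x v by have [_ /(_ v)[d _]] := FC 1%N; exact: d.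
have dG : derivable G x v by have [_ /(_ v)[d _]] := GC 1%N; exact: d.
have FG : forall y, (U `&` U') y -> A y -> (F * G) y = f y * g y.
  by move=> y [Uy Uy'] Ay; rewrite -Ff// -Gg.
rewrite (dwithin_ext (openI Uo Uo') (conj Ux Ux') Ax FG (derivableM dF dG)).
rewrite deriveM// (dwithin_ext Uo Ux Ax Ff dF) (dwithin_ext Uo' Ux' Ax Gg dG).
by rewrite -(Ff x Ux Ax) -(Gg x Ux' Ax) addrC mulrC.
Qed.

Lemma dwithinC (f : V -> R) x u v : smooth_on A f -> A x ->
  dwithin half_space (fun y => dwithin half_space f y u) x v =
  dwithin half_space (fun y => dwithin half_space f y v) x u.
Proof.
move=> sf Ax; have [U [F [Uo Ux FC Ff]]] := sf x Ax.
have [_ F2] := FC 2%N.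
have E w w' : dwithin half_space (fun y => dwithin half_space f y w) x w' =
    'D_w' (fun y => 'D_w F y) x.
  apply: (dwithin_ext Uo Ux Ax).
    move=> y Uy Ay; apply/esym; apply: dwithin_ext Ff _ => //.
    by have [d _] := F2 w; exact: d.
  by have [_ [_ /(_ w')[d _]]] := F2 w; exact: d.
by rewrite !E; apply: schwarz Uo Ux _; exact: FC.
Qed.

Lemma dwithin_coord (f : V -> R) x v : smooth_on A f -> A x ->
  dwithin half_space f x v =
  \sum_i v ord0 i * dwithin half_space f x (delta_mx ord0 i).
Proof.
move=> sf Ax; have [U [F [Uo Ux FC Ff]]] := sf x Ax.
have E w : dwithin half_space f x w = 'D_w F x.
  by apply: dwithin_ext Ff _ => //; have [_ /(_ w)[d _]] := FC 1%N; exact: d.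
under eq_bigr do rewrite E; rewrite E {1}[v]row_sum_delta.
elim/big_rec2: _ => [|i y1 y2 _ IH]; first exact: derive0.
by rewrite (derive_linear _ _ _ Uo Ux (FC 1%N)) IH.
Qed.

End DerivativeWithin.

(* The smooth functions on a coordinate set A, normalized to vanish outside A
   so that equality on A is equality. *)
Record smoothfn (R : realType) (n : nat) (A : set 'rV[R]_n) := SmoothFn {
  sfun :> 'rV[R]_n -> R;
  sfunP : smooth_on A sfun /\ forall y, ~ A y -> sfun y = 0
}.

(** * The ring of smooth functions on a coordinate set and its derivations *)

Section SmoothFunctionRing.
Context {R : realType} {n : nat} {A : set 'rV[R]_n}.
Local Notation V := 'rV[R]_n.
Local Notation S := (smoothfn A).
Implicit Types s t : S.

HB.instance Definition _ := gen_eqMixin (smoothfn A).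
HB.instance Definition _ := gen_choiceMixin (smoothfn A).

Lemma smoothfn_eq s t : (forall y, A y -> s y = t y) -> s = t.
Proof.
case: s t => [f [fs f0]] [g [gs g0]] /= fg.
have E : f = g.
  by apply/funext => y; have [/fg//|nA] := pselect (A y); rewrite f0// g0.
by case: g / E gs g0 fg => gs g0 _; congr SmoothFn; exact: Prop_irrelevance.
Qed.

Lemma smoothfn_smooth s : smooth_on A s. Proof. by case: s => f []. Qed.

Lemma zext_subproof (f : V -> R) : smooth_on A f ->
  smooth_on A (fun y => if y \in A then f y else 0) /\
  forall y, ~ A y -> (if y \in A then f y else 0) = 0.
Proof.
move=> sf; split=> [|y nA]; last by rewrite memNset.
by apply: smooth_on_ext sf => y Ay; rewrite mem_set.
Qed.

Definition mkS (f : V -> R) (sf : smooth_on A f) : S := SmoothFn (zext_subproof sf).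

Lemma mkSE (f : V -> R) (sf : smooth_on A f) y : A y -> mkS sf y = f y.
Proof. by move=> Ay /=; rewrite mem_set. Qed.

Definition sC (a : R) : S := mkS (@smooth_on_cst R V R A a).
Definition sadd s t : S := mkS (smooth_onD (smoothfn_smooth s) (smoothfn_smooth t)).
Definition smul s t : S := mkS (smooth_onM (smoothfn_smooth s) (smoothfn_smooth t)).
Definition sopp s : S := mkS (smooth_onN (smoothfn_smooth s)).

Let saddA : associative sadd.
Proof. by move=> s t u; apply: smoothfn_eq => y Ay; rewrite !mkSE// addrA. Qed.
Let saddC : commutative sadd.
Proof. by move=> s t; apply: smoothfn_eq => y Ay; rewrite !mkSE// addrC. Qed.
Let sadd0 : left_id (sC 0) sadd.
Proof. by move=> s; apply: smoothfn_eq => y Ay; rewrite !mkSE// add0r. Qed.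
Let saddN : left_inverse (sC 0) sopp sadd.
Proof. by move=> s; apply: smoothfn_eq => y Ay; rewrite !mkSE// addNr. Qed.

HB.instance Definition _ :=
  GRing.isZmodule.Build (smoothfn A) saddA saddC sadd0 saddN.

Let smulA : associative smul.
Proof. by move=> s t u; apply: smoothfn_eq => y Ay; rewrite !mkSE// mulrA. Qed.
Let smulC : commutative smul.
Proof. by move=> s t; apply: smoothfn_eq => y Ay; rewrite !mkSE// mulrC. Qed.
Let smul1 : left_id (sC 1) smul.
Proof. by move=> s; apply: smoothfn_eq => y Ay; rewrite !mkSE// mul1r. Qed.
Let smulD : left_distributive smul sadd.
Proof. by move=> s t u; apply: smoothfn_eq => y Ay; rewrite !mkSE// mulrDl. Qed.

HB.instance Definition _ :=
  GRing.Zmodule_isComPzRing.Build (smoothfn A) smulA smulC smul1 smulD.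

Lemma sfunD s t y : A y -> (s + t) y = s y + t y. Proof. exact: mkSE. Qed.
Lemma sfunM s t y : A y -> (s * t) y = s y * t y. Proof. exact: mkSE. Qed.
Lemma sfunN s y : A y -> (- s) y = - s y. Proof. exact: mkSE. Qed.
Lemma sfunC a y : A y -> sC a y = a. Proof. exact: mkSE. Qed.
Lemma sfun0 y : A y -> (0 : S) y = 0. Proof. exact: mkSE. Qed.
Lemma sfun1 y : A y -> (1 : S) y = 1. Proof. exact: mkSE. Qed.

Lemma sfun_sum (I : Type) (r : seq I) (P : pred I) (F : I -> S) y : A y ->
  (\sum_(i <- r | P i) F i) y = \sum_(i <- r | P i) F i y.
Proof.
by move=> Ay; elim/big_rec2: _ => [|i u v _ <-]; rewrite ?sfun0// sfunD.
Qed.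

Lemma sfun_nat k y : A y -> (k%:R : S) y = k%:R.
Proof.
by move=> Ay; elim: k => [|k IH]; rewrite ?sfun0// -!natr1 sfunD// IH sfun1.
Qed.

(* Opaque, to keep unification from comparing smoothness proofs. *)
Fact toS_subproof (f : V -> R) :
  {s : S | smooth_on A f -> forall y, A y -> s y = f y}.
Proof.
have [sf|nf] := pselect (smooth_on A f); last by exists 0.
by exists (mkS sf) => _ y; exact: mkSE.
Qed.

(* Zero when f is not smooth on A. *)
Definition toS (f : V -> R) : S := sval (toS_subproof f).

Lemma toSE (f : V -> R) y : smooth_on A f -> A y -> toS f y = f y.
Proof. by move=> sf; exact: (svalP (toS_subproof f) sf). Qed.

Definition sder (i : 'I_n) s : S :=
  toS (fun y => dwithin half_space s y (delta_mx ord0 i)).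

Context {O : set V}.
Hypothesis Oo : open O.
Hypothesis AE : A = O `&` half_space.

Lemma sderE i s y : A y -> sder i s y = dwithin half_space s y (delta_mx ord0 i).
Proof.
move=> Ay; apply: (toSE _ Ay); apply: (smooth_on_dwithin Oo AE).
exact: smoothfn_smooth.
Qed.

Lemma eq_dwithin (W : normedModType R) (f g : V -> W) x v :
  (forall y, A y -> f y = g y) -> A x ->
  dwithin half_space f x v = dwithin half_space g x v.
Proof.
move=> fg Ax; have Ox : O x by move: Ax; rewrite AE => -[].
have near_eq (f1 f2 : V -> W) : (forall y, A y -> f1 y = f2 y) ->
    {near hdir x v, dquot f1 x v =1 dquot f2 x v}.
  move=> E; have := near_hdir v Oo Ox; apply: filterS => h [Oh hh].
  by rewrite /dquot !E// AE.
(* No convergence is assumed, so the two image filters themselves are shown to be equal. *)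
rewrite /dwithin; congr lim; apply/seteqP; split.
  by apply: near_eq_cvg; apply: near_eq => y Ay; rewrite fg.
by apply: near_eq_cvg; apply: near_eq => y Ay; rewrite fg.
Qed.

Lemma sderD i s t : sder i (s + t) = sder i s + sder i t.
Proof.
apply: smoothfn_eq => y Ay; rewrite sfunD// !sderE//.
rewrite -(dwithinD Oo AE)//; [|exact: smoothfn_smooth|exact: smoothfn_smooth].
by apply: eq_dwithin => // z Az; rewrite sfunD.
Qed.

Lemma sderM i s t : sder i (s * t) = sder i s * t + s * sder i t.
Proof.
apply: smoothfn_eq => y Ay; rewrite sfunD// !sfunM// !sderE//.
rewrite -(dwithinM Oo AE)//; [|exact: smoothfn_smooth|exact: smoothfn_smooth].
by apply: eq_dwithin => // z Az; rewrite sfunM.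
Qed.

Lemma sderC i j s : sder i (sder j s) = sder j (sder i s).
Proof.
apply: smoothfn_eq => y Ay.
have E k l : sder k (sder l s) y = dwithin half_space
    (fun z => dwithin half_space s z (delta_mx ord0 l)) y (delta_mx ord0 k).
  rewrite (sderE k (sder l s) Ay).
  exact: (@eq_dwithin _ _ _ _ _ (fun z Az => sderE l s Az) Ay).
have C := dwithinC Oo AE (delta_mx ord0 j) (delta_mx ord0 i) (smoothfn_smooth s) Ay.
by apply: etrans (E i j) _; rewrite C; apply/esym; exact: E.
Qed.

Lemma sder_cst i a : sder i (sC a) = 0.
Proof.
apply: smoothfn_eq => y Ay; rewrite sderE// sfun0//.
rewrite (@eq_dwithin _ _ (fun=> a))//; last by move=> z Az; rewrite sfunC.
by apply: dwithin_cst; move: Ay; rewrite AE => -[].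
Qed.

Lemma dwithin_sfun s x v : A x ->
  dwithin half_space s x v = \sum_i v ord0 i * sder i s x.
Proof.
move=> Ax; rewrite (dwithin_coord Oo AE v (smoothfn_smooth s) Ax).
by apply: eq_bigr => i _; rewrite sderE.
Qed.

End SmoothFunctionRing.

(** * Real powers of a nonnegative smooth function *)

Section PowerDerivative.
Context {R : realType} {n : nat}.
Local Notation V := 'rV[R]_n.
Implicit Types (x v : V).

(** Restriction to the line through [x] along [v] reduces this to the chain rule in one variable. *)
Lemma is_derive_powR_comp (F : V -> R) x v (p : R) : derivable F x v -> 0 < F x ->
  is_derive x v (fun y => F y `^ p) (p * F x `^ (p - 1) * 'D_v F x).
Proof.
move=> dF Fx0.
have lineE (f : V -> R) : (fun h : R => h^-1 *: ((f \o shift x) (h *: v) - f x)) =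
    (fun h : R => h^-1 *: (((fun t : R => f (t *: v + x)) \o shift 0) (h *: 1)
       - f (0 *: v + x))).
  by apply/funext => h /=; rewrite addr0 scale0r add0r [h *: 1]mulr1.
pose g (t : R) := F (t *: v + x).
have g0 : g 0 = F x by rewrite /g scale0r add0r.
have dg : derivable g 0 1 by move: dF; rewrite /derivable lineE.
have dP : derivable (fun t : R => t `^ p) (g 0) 1.
  by apply: derivable_powR; rewrite g0 in_itv /= Fx0.
have dC : derivable ((fun t : R => t `^ p) \o g) 0 1.
  by apply/derivable1_diffP/differentiable_comp; apply/derivable1_diffP.
apply: DeriveDef; first by rewrite /derivable lineE.
have -> : 'D_v (fun y => F y `^ p) x = 'D_1 ((fun t : R => t `^ p) \o g) 0.
  by rewrite /derive lineE.
have -> : 'D_v F x = 'D_1 g 0 by rewrite /derive lineE.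
rewrite -!derive1E derive1_comp// powR_derive1 ?g0//.
by rewrite in_itv /= Fx0.
Qed.

Context {A O : set V}.
Hypothesis Oo : open O.
Hypothesis AE : A = O `&` half_space.

Lemma cvg_hdir (f : V -> R) x v : smooth_on A f -> A x ->
  f (h *: v + x) @[h --> hdir x v] --> f x.
Proof.
move=> sf Ax; have P := hdir_proper v (chart_half_space AE Ax).
have h0 : (fun h : R => h) @ hdir x v --> (0 : R).
  by apply: cvg_trans (@cvg_within _ (0 : R)^' _ _) _; exact: cvg_within.
have L : (fun h => h * dquot f x v h + f x) @ hdir x v -->
    0 * dwithin half_space f x v + f x.
  by apply: cvgD; [exact: (cvgM h0 (dquot_cvg Oo AE sf Ax)) | exact: cvg_cst].
rewrite mul0r add0r in L; apply: cvg_trans L; apply: near_eq_cvg.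
have : \forall h \near hdir x v, h != 0.
  by rewrite near_withinE; near=> h => _; near: h; exact: nbhs_dnbhs_neq.
apply: filterS => h hn0; rewrite /dquot.
by rewrite /GRing.scale /= mulrA divff// mul1r subrK.
Unshelve. all: by end_near. Qed.

(** A product rule meant for a power of [w] as the first factor, which need not be smooth: all that
    is asked of [f] is a limit of its difference quotient at [x]. *)
Lemma dwithin_mul_cvg (f s : V -> R) x v (l : R) : smooth_on A s -> A x ->
  dquot f x v @ hdir x v --> l ->
  dwithin half_space (fun y => f y * s y) x v =
  l * s x + f x * dwithin half_space s x v.
Proof.
move=> ss Ax fl; have hx := chart_half_space AE Ax; have P := hdir_proper v hx.
apply: dwithin_lim => //.
have -> : dquot (fun y => f y * s y) x v =
    (fun h => dquot f x v h * s (h *: v + x) + f x * dquot s x v h).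
  apply/funext => h; rewrite /dquot /GRing.scale /=; ring.
apply: cvgD; first by apply: (cvgM fl); exact: cvg_hdir.
by apply: cvgM; [exact: cvg_cst | exact: (dquot_cvg Oo AE ss Ax)].
Qed.

(* At a zero of f the exponent exceeds 2, so f^(m+1) vanishes to first order. *)
Lemma dquot_powR_cvg (f : V -> R) x v (m : R) : 1 < m -> smooth_on A f ->
  (forall y, A y -> 0 <= f y) -> A x ->
  dquot (fun y => f y `^ (m + 1)) x v @ hdir x v -->
  (m + 1) * f x `^ m * dwithin half_space f x v.
Proof.
move=> m1 sf f0 Ax; have P := hdir_proper v (chart_half_space AE Ax).
have m0 : 0 < m by apply: lt_trans m1.
have [U [F [Uo Ux FC Ff]]] := sf x Ax.
have dF : derivable F x v by have [_ /(_ v)[d _]] := FC 1%N; exact: d.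
have := f0 x Ax; rewrite le_eqVlt => /predU1P[fx0|fx0]; last first.
  have Fx0 : 0 < F x by rewrite Ff.
  have dP := is_derive_powR_comp (m + 1) dF Fx0.
  rewrite (dwithin_ext Oo AE Uo Ux Ax Ff dF) -(Ff x Ux Ax).
  have := @derive_val _ _ _ _ _ _ _ dP; rewrite addrK => <-.
  apply: (dquot_cvg_ext Oo AE Uo Ux Ax); last by case: dP.
  by move=> y Uy Ay /=; rewrite Ff.
rewrite -fx0 powR0 ?gt_eqF// mulr0 mul0r.
have fc := cvg_hdir v sf Ax; rewrite -fx0 in fc.
have Ox : O x by move: Ax; rewrite AE => -[].
have nA : \forall h \near hdir x v, A (h *: v + x).
  by have := near_hdir v Oo Ox; apply: filterS => h; rewrite AE.
(* Close to a zero, [f] lies between 0 and 1, hence f^m lies between 0 and [f] because m > 1. *)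
have pc : (fun h => f (h *: v + x) `^ m) @ hdir x v --> (0 : R).
  apply: (@squeeze_cvgr _ _ _ _ (fun=> 0) (fun h => f (h *: v + x))) => //;
    last exact: cvg_cst.
  near=> h; rewrite powR_ge0 /=.
  have Ah : A (h *: v + x) by near: h.
  have f1 : f (h *: v + x) <= 1.
    by near: h; apply: (cvgr_le _ fc); exact: ltr01.
  have := f0 _ Ah; rewrite le_eqVlt => /predU1P[<-|fh]; first by rewrite powR0 ?gt_eqF.
  by apply: ge1r_powR; [rewrite fh | exact: ltW].
(* Since [f x = 0], the quotient of f^(m+1) is the quotient of [f] times f^m at the displaced
   point. *)
have L : (fun h => dquot f x v h * f (h *: v + x) `^ m) @ hdir x v -->
    dwithin half_space f x v * 0.
  exact: (cvgM (dquot_cvg Oo AE sf Ax) pc).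
rewrite mulr0 in L; apply: cvg_trans L; apply: near_eq_cvg.
apply: filterS nA => h Ah; rewrite /dquot -fx0 powR0 ?gt_eqF ?addr_gt0// !subr0.
rewrite /GRing.scale /= -mulrA; congr (_ * _).
by rewrite -[in RHS](mulr_powRB1 (f0 _ Ah)) ?addr_gt0// addrK.
Unshelve. all: by end_near. Qed.

End PowerDerivative.

(** * Evaluation at a point and smoothness of the inverse matrix *)

Section Evaluation.
Context {R : realType} {n : nat} {A : set 'rV[R]_n}.
Local Notation S := (smoothfn A).

(** Named so as to carry the ring morphism structure, through which determinants and adjugates over
    the ring are computed pointwise. *)
Definition sev y (Ay : A y) (s : S) : R := s y.

Lemma sev_zmod y (Ay : A y) : zmod_morphism (sev Ay).
Proof. by move=> s t; rewrite /sev sfunD// sfunN. Qed.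

Lemma sev_monoid y (Ay : A y) : monoid_morphism (sev Ay).
Proof. by split=> [|s t]; rewrite /sev ?sfun1// sfunM. Qed.

HB.instance Definition _ y (Ay : A y) :=
  GRing.isZmodMorphism.Build S R (sev Ay) (sev_zmod Ay).
HB.instance Definition _ y (Ay : A y) :=
  GRing.isMonoidMorphism.Build S R (sev Ay) (sev_monoid Ay).

(** Cramer's rule: the determinant and the adjugate, taken over the ring of smooth functions, are
    smooth by construction. *)
Lemma smooth_on_invmx (G : 'rV[R]_n -> 'M[R]_n) a b : smooth_on A G ->
  (forall y, A y -> G y \in unitmx) ->
  smooth_on A (fun y => invmx (G y) a b).
Proof.
move=> Gs Gu.
pose M : 'M[S]_n := \matrix_(i, j) toS (fun y => G y i j).
have ME y (Ay : A y) : map_mx (sev Ay) M = G y.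
  by apply/matrixP => i j; rewrite !mxE /sev toSE//; exact: smooth_on_coord.
have dE y : A y -> (\det M) y = \det (G y).
  by move=> Ay; rewrite -(ME y Ay) det_map_mx.
have aE y : A y -> (\adj M a b) y = \adj (G y) a b.
  by move=> Ay; rewrite -(ME y Ay) -map_mx_adj [RHS]mxE.
have d0 y : A y -> (\det M) y != 0.
  by move=> Ay; rewrite dE// -unitfE -unitmxE; exact: Gu.
have := smooth_onM (smooth_onV d0 (smoothfn_smooth _)) (smoothfn_smooth (\adj M a b)).
by apply: smooth_on_ext => y Ay; rewrite /invmx Gu// [RHS]mxE dE// aE.
Qed.

End Evaluation.

(** * Translation of the geometry of a chart into the ring of smooth functions *)

Section Chart.
Context {R : realType} {n : nat} {A O : set 'rV[R]_n}.
Hypothesis Oo : open O.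
Hypothesis AE : A = O `&` half_space.
Variable G : 'rV[R]_n -> 'M[R]_n.
Hypothesis Gs : smooth_on A G.
Hypothesis Gsym : forall x, A x -> (G x)^T = G x.
Hypothesis Gpos : forall x u, A x -> u != 0 -> 0 < dot G x u u.

Local Notation V := 'rV[R]_n.
Local Notation S := (smoothfn A).
Local Notation D := (@sder R n A).
Implicit Types (X Y Z U W : V -> V) (Xs Ys Zs Us Ws : 'rV[S]_n) (x y : V).

(** A nonzero vector in the kernel of [G y] would have length zero. *)
Lemma metric_unitmx y : A y -> G y \in unitmx.
Proof.
move=> Ay; rewrite -row_free_unit -kermx_eq0; apply/eqP/row_matrixP => i.
rewrite row0; apply/eqP/negPn/negP => /(Gpos Ay).
by rewrite /dot -row_mul mulmx_ker row0 mul0mx mxE ltxx.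
Qed.

Definition gfn : 'M[S]_n := \matrix_(a, b) toS (fun y => G y a b).
Definition gifn : 'M[S]_n := \matrix_(a, b) toS (fun y => invmx (G y) a b).

Lemma gfnE a b y : A y -> gfn a b y = G y a b.
Proof. by move=> Ay; rewrite mxE toSE//; exact: smooth_on_coord. Qed.

Lemma gifnE a b y : A y -> gifn a b y = invmx (G y) a b.
Proof.
by move=> Ay; rewrite mxE toSE//; apply: smooth_on_invmx => //; exact: metric_unitmx.
Qed.

Definition Gmfn a : 'M[S]_n := \matrix_(b, k) (sC 2^-1 * \sum_l gifn k l *
  (D a (gfn b l) + D b (gfn a l) - D l (gfn a b))).

Lemma sder_gfn a b c y : A y -> D a (gfn b c) y = dmetric G a b c y.
Proof.
move=> Ay; rewrite (sderE Oo AE a _ Ay).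
exact: (@eq_dwithin _ _ _ _ Oo AE _ _ _ _ _ (fun z Az => gfnE b c Az) Ay).
Qed.

Lemma GmfnE a b k y : A y -> Gmfn a b k y = christoffel G k a b y.
Proof.
move=> Ay; rewrite mxE sfunM// sfunC// sfun_sum// /christoffel; congr (_ * _).
apply: eq_bigr => l _; rewrite sfunM// gifnE// sfunD// sfunD// sfunN//.
by rewrite !sder_gfn.
Qed.

Lemma dmetric_sym a b c y : A y -> dmetric G a b c y = dmetric G a c b y.
Proof.
move=> Ay; apply: (eq_dwithin Oo AE) => // z Az.
by rewrite -[in LHS](Gsym Az) mxE.
Qed.

Lemma Gmfn_sym a b k : Gmfn a b k = Gmfn b a k.
Proof.
apply: smoothfn_eq => y Ay; rewrite !GmfnE//; apply: christoffel_sym => *.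
exact: dmetric_sym.
Qed.

Lemma gfn_sym : gfn^T = gfn.
Proof.
apply/matrixP => a b; rewrite mxE; apply: smoothfn_eq => y Ay.
by rewrite !gfnE// -[in LHS](Gsym Ay) mxE.
Qed.

Lemma gfn_inv : gfn *m gifn = 1%:M.
Proof.
apply/matrixP => a b; apply: smoothfn_eq => y Ay.
rewrite !mxE sfun_sum// sfun_nat//.
have /matrixP/(_ a b) := mulmxV (metric_unitmx Ay); rewrite !mxE => <-.
by apply: eq_bigr => k _; rewrite sfunM// gfnE// gifnE.
Qed.

Lemma gfn_compat e : dmx D e gfn = Gmfn e *m gfn + gfn *m (Gmfn e)^T.
Proof.
apply/matrixP => a b; apply: smoothfn_eq => y Ay.
rewrite addmxE sfunD// [dmx _ _ _ _ _]mxE sder_gfn//.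
rewrite [(Gmfn e *m gfn) _ _]mxE [(gfn *m _) _ _]mxE !sfun_sum//.
rewrite christoffel_metric; last 3 first.
- exact: metric_unitmx.
- exact: Gsym.
- by move=> *; exact: dmetric_sym.
rewrite big_split; congr (_ + _); apply: eq_bigr => l _.
  by rewrite sfunM// GmfnE// gfnE.
by rewrite sfunM// [(Gmfn e)^T _ _]mxE GmfnE// gfnE// mulrC.
Qed.

(* The vector field X has the components Xs; values outside A are irrelevant. *)
Definition reprf X Xs := forall y, A y -> X y = \row_k Xs ord0 k y.

Lemma reprfE X Xs y k : reprf X Xs -> A y -> X y ord0 k = Xs ord0 k y.
Proof. by move=> XX /XX ->; rewrite mxE. Qed.

Lemma repr_smooth X : smooth_on A X -> reprf X (\row_k toS (fun y => X y ord0 k)).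
Proof.
move=> sX y Ay; apply/rowP => k; rewrite !mxE toSE//; exact: smooth_on_coord.
Qed.

Lemma repr_coord a : reprf (coord_field a) (delta_mx ord0 a).
Proof. by move=> y Ay; apply/rowP => k; rewrite !mxE sfun_nat. Qed.

Lemma dwithin_repr X Xs x v : reprf X Xs -> A x ->
  dwithin half_space X x v = \row_k \sum_i v ord0 i * D i (Xs ord0 k) x.
Proof.
move=> XX Ax; rewrite (eq_dwithin Oo AE v XX Ax); apply: dwithin_lim.
  exact: chart_half_space AE _ Ax.
apply: dquot_mx; first exact: chart_half_space AE _ Ax.
move=> i j; rewrite (ord1 i) mxE -(dwithin_sfun Oo AE)//.
rewrite (_ : (fun y => _) = Xs ord0 j); last by apply/funext => y; rewrite mxE.
exact: (@dquot_cvg R n A O Oo AE (Xs ord0 j) x v (smoothfn_smooth _) Ax).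
Qed.

Lemma lie_der_repr (f : V -> R) (s : S) X Xs x :
  (forall y, A y -> f y = s y) -> reprf X Xs -> A x ->
  lie_der X f x = derU D Xs s x.
Proof.
move=> fs XX Ax; rewrite /lie_der (eq_dwithin Oo AE _ fs Ax).
rewrite (dwithin_sfun Oo AE)// sfun_sum//; apply: eq_bigr => i _.
by rewrite sfunM// (reprfE i XX Ax).
Qed.

Lemma nabla_repr X Y Xs Ys : reprf X Xs -> reprf Y Ys ->
  reprf (nabla G X Y) (nab D Gmfn Xs Ys).
Proof.
move=> XX YY y Ay; rewrite /nabla (dwithin_repr _ YY Ay).
apply/rowP => k; rewrite !mxE summxE sfun_sum// -big_split; apply: eq_bigr => i _.
rewrite !mxE sfunM// sfunD// mulrDr (reprfE i XX Ay); congr (_ + _).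
rewrite sfun_sum// mulr_sumr; apply: eq_bigr => j _.
by rewrite sfunM// GmfnE// (reprfE j YY Ay); ring.
Qed.

Lemma lie_bracket_repr X Y Xs Ys : reprf X Xs -> reprf Y Ys ->
  reprf (lie_bracket X Y) (lieb D Xs Ys).
Proof.
move=> XX YY y Ay; rewrite /lie_bracket (dwithin_repr _ YY Ay) (dwithin_repr _ XX Ay).
apply/rowP => k; rewrite !mxE sfunD// sfunN// !sfun_sum//; congr (_ - _);
  apply: eq_bigr => i _; by rewrite sfunM// (reprfE i XX Ay, reprfE i YY Ay).
Qed.

Lemma repr_sub X Y Xs Ys : reprf X Xs -> reprf Y Ys ->
  reprf (fun y => X y - Y y) (Xs - Ys).
Proof.
move=> XX YY y Ay; rewrite XX// YY//; apply/rowP => k.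
by rewrite !mxE sfunD// sfunN.
Qed.

Lemma curvature_repr X Y Z Xs Ys Zs : reprf X Xs -> reprf Y Ys -> reprf Z Zs ->
  reprf (curvature G X Y Z) (curvf D Gmfn Xs Ys Zs).
Proof.
move=> XX YY ZZ; apply: repr_sub; first apply: repr_sub.
- by apply: nabla_repr => //; exact: nabla_repr.
- by apply: nabla_repr => //; exact: nabla_repr.
- by apply: nabla_repr => //; exact: lie_bracket_repr.
Qed.

Lemma dot_repr X Y Xs Ys y : reprf X Xs -> reprf Y Ys -> A y ->
  dot G y (X y) (Y y) = ((Xs *m gfn *m Ys^T) ord0 ord0) y.
Proof.
move=> XX YY Ay; rewrite /dot [LHS]mxE [X in _ = sfun X _]mxE sfun_sum//.
apply: eq_bigr => j _; rewrite sfunM// ![_^T _ _]mxE (reprfE j YY Ay).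
congr (_ * _); rewrite [LHS]mxE [X in _ = sfun X _]mxE sfun_sum//.
by apply: eq_bigr => k _; rewrite sfunM// gfnE// (reprfE k XX Ay).
Qed.

Lemma RmE X Y Z W Xs Ys Zs Ws y :
  reprf X Xs -> reprf Y Ys -> reprf Z Zs -> reprf W Ws -> A y ->
  Rm G X Y Z W y = ev4 (Rd D Gmfn gfn) Xs Ys Zs Ws y.
Proof.
move=> XX YY ZZ WW Ay.
by rewrite /Rm (dot_repr (curvature_repr XX YY ZZ) WW Ay) (Rm_ev4 (sderD Oo AE) (sderM Oo AE) (sderC Oo AE)).
Qed.

Lemma metricE X Y Xs Ys y : reprf X Xs -> reprf Y Ys -> A y ->
  metric G X Y y = ev2 (fun a b => gfn a b) Xs Ys y.
Proof.
move=> XX YY Ay; rewrite /metric (dot_repr XX YY Ay); congr (sfun _ y).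
rewrite -mulmxA mxE; apply: eq_bigr => a _; congr (_ * _).
by rewrite mxE; apply: eq_bigr => b _; rewrite [_^T _ _]mxE mulrC.
Qed.

(** Agreement is asked at the single point [y], so [t] may depend on [y]. *)
Lemma mtraceE T t y : A y ->
  (forall i j, T (coord_field i) (coord_field j) y = (t i j : S) y) ->
  mtrace G T y = tr2 gifn t y.
Proof.
move=> Ay E; rewrite /mtrace /tr2 sfun_sum//; apply: eq_bigr => i _.
by rewrite sfun_sum//; apply: eq_bigr => j _; rewrite sfunM// gifnE// E.
Qed.

Lemma RicE X Y Xs Ys y : reprf X Xs -> reprf Y Ys -> A y ->
  Ric G X Y y = ev2 (Rc D Gmfn gfn gifn) Xs Ys y.
Proof.
move=> XX YY Ay; rewrite -[ev2 _ _ _](tr2_ev4 gifn (Rd D Gmfn gfn)).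
apply: mtraceE => // i j.
exact: RmE XX (repr_coord i) (repr_coord j) YY Ay.
Qed.

Lemma Ric_coordE i j y : A y ->
  Ric G (coord_field i) (coord_field j) y = Rc D Gmfn gfn gifn i j y.
Proof.
move=> Ay; rewrite (RicE (repr_coord i) (repr_coord j) Ay) /ev2.
by rewrite !ct_delta.
Qed.

Lemma scalE y : A y -> scal G y = sc D Gmfn gfn gifn y.
Proof. by move=> Ay; apply: mtraceE => // i j; exact: Ric_coordE. Qed.

(** * The tensor Q in the ring *)

Section Quasi.
Variables (lambda m : R).

Definition Qfn := Qd D Gmfn gfn gifn (sC m^-1) (sC (m - 1)^-1) (sC 2^-1) (sC lambda).

Lemma rhoE y : A y ->
  rho G lambda m y = rhod D Gmfn gfn gifn (sC (m - 1)^-1) (sC lambda) y.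
Proof.
move=> Ay; rewrite /rho /rhod sfunM// sfunC// sfunD// sfunN// sfunM//.
by rewrite sfunD// sfunN// sfun_nat// sfun1// sfunC// scalE.
Qed.

Lemma odotE (s r : tensor2) (s' r' : 'I_n -> 'I_n -> S) X Y Z W Xs Ys Zs Ws y :
  (forall U Us V' Vs, reprf U Us -> reprf V' Vs -> s U V' y = ev2 s' Us Vs y) ->
  (forall U Us V' Vs, reprf U Us -> reprf V' Vs -> r U V' y = ev2 r' Us Vs y) ->
  reprf X Xs -> reprf Y Ys -> reprf Z Zs -> reprf W Ws -> A y ->
  odot s r X Y Z W y = ev4 (odt (sC 2^-1) s' r') Xs Ys Zs Ws y.
Proof.
move=> sE rE XX YY ZZ WW Ay; rewrite /odot ev4_odt sfunM// sfunC//; congr (_ * _).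
rewrite !sfunD// !sfunN// !sfunM//.
rewrite (sE _ _ _ _ YY ZZ) (sE _ _ _ _ XX WW) (sE _ _ _ _ YY WW) (sE _ _ _ _ XX ZZ).
by rewrite (rE _ _ _ _ YY ZZ) (rE _ _ _ _ XX WW) (rE _ _ _ _ YY WW) (rE _ _ _ _ XX ZZ).
Qed.

Lemma QtensorE X Y Z W Xs Ys Zs Ws y :
  reprf X Xs -> reprf Y Ys -> reprf Z Zs -> reprf W Ws -> A y ->
  Qtensor G lambda m X Y Z W y = ev4 Qfn Xs Ys Zs Ws y.
Proof.
move=> XX YY ZZ WW Ay.
have mE U Us V' Vs : reprf U Us -> reprf V' Vs ->
    metric G U V' y = ev2 (fun a b => gfn a b) Us Vs y.
  by move=> UU VV; exact: metricE.
have rE U Us V' Vs : reprf U Us -> reprf V' Vs ->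
    Ric G U V' y = ev2 (Rc D Gmfn gfn gifn) Us Vs y.
  by move=> UU VV; exact: RicE.
rewrite /Qtensor (RmE XX YY ZZ WW Ay) (odotE rE mE XX YY ZZ WW Ay).
rewrite (odotE mE mE XX YY ZZ WW Ay) rhoE//.
set rh := rhod _ _ _ _ _ _.
have -> : ev4 Qfn Xs Ys Zs Ws = ev4 (Rd D Gmfn gfn) Xs Ys Zs Ws
    + 2 * sC m^-1 * ev4 (odt (sC 2^-1) (Rc D Gmfn gfn gifn) (fun a b => gfn a b)) Xs Ys Zs Ws
    + (- ((sC lambda + rh) * sC m^-1)) *
        ev4 (odt (sC 2^-1) (fun a b => gfn a b) (fun a b => gfn a b)) Xs Ys Zs Ws.
  rewrite -!ev4Z -!ev4D; apply: ev4_ext => a b c d.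
  by rewrite /Qfn /Qd -/rh; ring.
clearbody rh.
rewrite !sfunD// !sfunM// sfunN// !sfunM// sfun_nat// !sfunD// !sfunC//.
by rewrite mulNr.
Qed.

End Quasi.

(** * The divergence in a chart for a solution of the Einstein equation *)

Section EinsteinFunction.
Variables (lambda m : R) (f : V -> R).
Hypothesis m1 : 1 < m.
Hypothesis fs : smooth_on A f.
Hypothesis f0 : forall y, A y -> 0 <= f y.
Hypothesis einstein_coord : forall b c y, A y ->
  Hess G f (coord_field b) (coord_field c) y =
  f y / m * (Ric G (coord_field b) (coord_field c) y
             - lambda * metric G (coord_field b) (coord_field c) y).

Definition ffn : S := toS f.

Lemma ffnE y : A y -> f y = ffn y.
Proof. by move=> Ay; rewrite toSE. Qed.

(** Coordinate fields have constant components, so their covariant derivatives have the Christoffel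
    symbols as components. *)
Lemma HessE b c y : A y ->
  Hess G f (coord_field b) (coord_field c) y = hess D Gmfn ffn b c y.
Proof.
move=> Ay; rewrite /Hess /hess sfunD// sfunN//; congr (_ - _).
  have E z : A z -> lie_der (coord_field c) f z = D c ffn z.
    move=> Az; rewrite (lie_der_repr ffnE (repr_coord c) Az).
    by rewrite /derU ct_delta.
  by rewrite (lie_der_repr E (repr_coord b) Ay) /derU ct_delta.
rewrite (lie_der_repr ffnE (nabla_repr (repr_coord b) (repr_coord c)) Ay).
congr (sfun _ y); rewrite /derU /nab ct_suml -/(ct _ _) ct_delta /ct /con.
apply: eq_bigr => k _; congr (_ * _); rewrite /nabE addmxE.
rewrite [X in _ + X]mxE [X in _ + X](ct_delta c (fun j => Gmfn b j k)).
rewrite [X in X + _]mxE [delta_mx _ _ _ _]mxE der_nat ?add0r//.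
- exact: sderD Oo AE.
- exact: sderM Oo AE.
Qed.

(** Only the difference quotient of f^(m+1) at [x] is used. The real number f(x)^m factors out of
    the product rule, and the other factor lies in the ring. *)
Lemma nabla4_fscaleQ U X Y Z W Us Xs Ys Zs Ws x :
  reprf U Us -> reprf X Xs -> reprf Y Ys -> reprf Z Zs -> reprf W Ws -> A x ->
  nabla4 G U (fscale (fun y => f y `^ (m + 1)) (Qtensor G lambda m)) X Y Z W x =
  f x `^ m * (ffn * ct Us (fun e => ev4 (cov4 D Gmfn e (Qfn lambda m)) Xs Ys Zs Ws)
    + (sC m + 1) * (derU D Us ffn * ev4 (Qfn lambda m) Xs Ys Zs Ws)) x.
Proof.
move=> UU XX YY ZZ WW Ax.
set T := ev4 (Qfn lambda m) Xs Ys Zs Ws.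
have TE y : A y -> fscale (fun y => f y `^ (m + 1)) (Qtensor G lambda m) X Y Z W y =
    f y `^ (m + 1) * T y.
  by move=> Ay; rewrite /fscale (QtensorE lambda m XX YY ZZ WW Ay).
have fl := dquot_powR_cvg Oo AE (v := U x) m1 fs f0 Ax.
rewrite /nabla4 {1}/lie_der (eq_dwithin Oo AE _ TE Ax).
rewrite (dwithin_mul_cvg Oo AE (smoothfn_smooth T) Ax fl).
rewrite -/(lie_der U f x) (lie_der_repr ffnE UU Ax) -/(lie_der U T x).
rewrite (lie_der_repr (fun y _ => erefl (T y)) UU Ax) /fscale.
rewrite (QtensorE lambda m (nabla_repr UU XX) YY ZZ WW Ax).
rewrite (QtensorE lambda m XX (nabla_repr UU YY) ZZ WW Ax).
rewrite (QtensorE lambda m XX YY (nabla_repr UU ZZ) WW Ax).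
rewrite (QtensorE lambda m XX YY ZZ (nabla_repr UU WW) Ax).
rewrite -(derU_ev4 (sderD Oo AE) (sderM Oo AE)) -/T.
have fp : f x `^ (m + 1) = f x * f x `^ m.
  have mp : 0 < m + 1 by rewrite addr_gt0// (lt_trans _ m1).
  by rewrite -(mulr_powRB1 (f0 Ax) mp) addrK.
rewrite fp sfunD// !sfunM// !sfunD// !sfunN// sfunC// sfun1// -ffnE//.
ring.
Qed.

Lemma div4_fscaleQ X Y Z x :
  smooth_on A X -> smooth_on A Y -> smooth_on A Z -> A x ->
  div4 G (fscale (fun y => f y `^ (m + 1)) (Qtensor G lambda m)) X Y Z x = 0.
Proof.
move=> /repr_smooth XX /repr_smooth YY /repr_smooth ZZ Ax.
set Xs := \row_k _ in XX; set Ys := \row_k _ in YY; set Zs := \row_k _ in ZZ.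
pose t i j : S := ffn * ev4 (cov4 D Gmfn i (Qfn lambda m)) Xs Ys Zs (delta_mx ord0 j)
    + (sC m + 1) * (D i ffn * ev4 (Qfn lambda m) Xs Ys Zs (delta_mx ord0 j)).
(* With [x] fixed, f(x)^m enters the ring as a constant function; the function f^m itself may fail
   to be smooth at a zero of [f]. *)
have -> : div4 G (fscale (fun y => f y `^ (m + 1)) (Qtensor G lambda m)) X Y Z x =
    tr2 gifn (fun i j => sC (f x `^ m) * t i j) x.
  apply: mtraceE => // i j.
  rewrite (nabla4_fscaleQ (repr_coord i) XX YY ZZ (repr_coord j) Ax) /derU !ct_delta.
  by rewrite [RHS]sfunM// sfunC.
have m0 : m != 0 by rewrite gt_eqF// (lt_trans _ m1).
have m10 : m - 1 != 0 by rewrite subr_eq0 gt_eqF.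
have -> : tr2 gifn (fun i j => sC (f x `^ m) * t i j) = 0; last exact: sfun0.
rewrite tr2Z (div_grad_Q_fields (sderD Oo AE) (sderM Oo AE) (sderC Oo AE) Gmfn_sym
  gfn_sym gfn_inv gfn_compat) ?mulr0//.
- by apply: smoothfn_eq => y Ay; rewrite sfunM// !sfunC// ?sfun1// divff.
- apply: smoothfn_eq => y Ay; rewrite sfunM// sfunD// sfunN// !sfunC// ?sfun1//.
  by rewrite divff.
- by apply: smoothfn_eq => y Ay; rewrite sfunM// sfun_nat// sfunC// ?sfun1// divff.
- move=> e; exact: sder_cst Oo AE _ _.
- move=> e; exact: sder_cst Oo AE _ _.
- move=> e; exact: sder_cst Oo AE _ _.
move=> b c; apply: smoothfn_eq => y Ay.
rewrite -HessE// einstein_coord// Ric_coordE// !sfunM// sfunC// -ffnE//.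
rewrite sfunD// sfunN// sfunM// sfunC//; congr (_ * (_ - _ * _)).
rewrite (metricE (repr_coord b) (repr_coord c) Ay) /ev2.
by rewrite !ct_delta.
Qed.

End EinsteinFunction.

End Chart.

Theorem proposition6p3 (R : realType) (n : nat) (M : smooth_manifold R n)
    (g : riemannian_metric M) (w : M -> R) (lambda m : R) :
  1 < m ->
  einstein_manifold g w lambda m ->
  forall (i : cindex M) (X Y Z : 'rV[R]_n -> 'rV[R]_n),
    smooth_on (coords i) X -> smooth_on (coords i) Y -> smooth_on (coords i) Z ->
    forall x, coords i x ->
      div4 (g i)
        (fscale (fun y => w (param i y) `^ (m + 1)) (Qtensor (g i) lambda m))
        X Y Z x = 0.
Proof.
move=> m1 E i X Y Z Xs Ys Zs x Ax.
case: (chart_image_open i) => O Oo AE.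
have sw : smooth_on (coords i) (w \o param i) by exact: (einstein_smooth E).
apply: (@div4_fscaleQ R n (coords i) O Oo AE (g i) _ _ _ lambda m (w \o param i)) => //.
- exact: gmx_smooth.
- exact: gmx_sym.
- exact: gmx_posdef.
(* Nonnegativity of [w] on the whole chart: zero at boundary points, positive at all others. *)
- move=> y [p ip <-] /=; rewrite chartK//.
  have [pb|npb] := pselect (boundary p); first by rewrite (einstein_bnd E pb).
  exact: ltW (einstein_int E npb).
(* Coordinate fields are constant, hence admissible in the Einstein equation. *)
- move=> b c y Ay; apply: (einstein_eq E) => //; exact: smooth_on_cst.
Qed.
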